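(* Fix $N\ge 2$ and consider any natural frequencies $\boldsymbol\omega=(\omega_i)_{i=1}^N\in\mathbb{R}^N$. For $\boldsymbol\alpha\in\mathbb{T}^N$ let $\boldsymbol\theta^{\epsilon,\boldsymbol\alpha}(t)$ be the solution of the KRW system and $\overline{\boldsymbol\theta^{\boldsymbol\alpha}}(t)$ the solution of the averaged system, both with initial condition $\boldsymbol\alpha$. Then, for any finite $T$, $$\lim_{\epsilon\to0}\ \sup_{\boldsymbol\alpha\in\mathbb{T}^N}\mathbb{E}\Big[\sup_{t\in[0,T]}\big\|\boldsymbol\theta^{\epsilon,\boldsymbol\alpha}(t)-\overline{\boldsymbol\theta^{\boldsymbol\alpha}}(t)\big\|_\infty\Big]=0.$$
   Context: Skeleton. $\mathbb{G}=(V,E)$ is a finite connected graph with symmetric weights $\pi(u,v)=\pi(v,u)\in[0,\infty)$ for $u,v\in V$; the edges are the pairs $\{u,v\}$ (possibly $u=v$) with $\pi(u,v)>0$, and every vertex has a self-loop: $\pi(u,u)>0$ for all $u\in V$. Put $\pi(u)=\sum_{v\in V}\pi(u,v)$. $K>0$ is a constant. $\mathbb{T}^N=(\mathbb{R}/2\pi\mathbb{Z})^N$; $\|\cdot\|_\infty$ is the maximum over components, where the absolute value of a difference of two elements of $\mathbb{T}$ is their geodesic distance in $[0,\pi]$. Kuramoto Random Walk (KRW). For $\epsilon\in(0,\infty)$, $\mathbf X^\epsilon(t)=(X^\epsilon_1(t),\dots,X^\epsilon_N(t))$ consists of $N$ independent continuous-time random walks on $\mathbb{G}$: each walk jumps at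 constant rate $\epsilon^{-1}$, and from $u$ it jumps to $v$ with probability $\pi(u,v)/\pi(u)$. The starting point $\mathbf X^\epsilon(0)=\mathbf x_0^\epsilon\in V^N$ is given. For $\mathbf x\in V^N$ let $a_{ij}(\mathbf x)=\pi(x_i,x_j)$. The KRW system is $$\frac{d}{dt}\theta^\epsilon_i(t)=\omega_i+\frac{K}{N}\sum_{j=1}^N a_{ij}(\mathbf X^\epsilon(t))\sin\big(\theta^\epsilon_j(t)-\theta^\epsilon_i(t)\big),\quad i=1,\dots,N,\ t\ge0,$$ whose solutions (in the Carathéodory sense, for every realization of the walks) exist and are unique. Averaged system. Let $\mu(u)=\pi(u)/\sum_{v\in V}\pi(v)$ be the reversible probability measure of a single walk and $\overline a=\sum_{u,v\in V}\pi(u,v)\mu(u)\mu(v)>0$. The averaged system is $$\frac{d}{dt}\overline\theta_i(t)=\omega_i+\frac{K}{N}\sum_{j=1}^N\overline a\,\sin\big(\overline\theta_j(t)-\overline\theta_i(t)\big),\quad i=1,\dots,N,\ t\ge0.$$ *)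

(* Defs.v *)
From HB Require Import structures.
From mathcomp Require Import all_boot all_order all_algebra.
From mathcomp Require Import generic_quotient ring_quotient.
From mathcomp Require Import all_classical all_reals all_analysis.
Set Implicit Arguments.
Unset Strict Implicit.
Unset Printing Implicit Defensive.
Import Order.TTheory GRing.Theory Num.Theory.
Import numFieldNormedType.Exports.
Local Open Scope classical_set_scope.
Local Open Scope ring_scope.

Definition two_pi_int (R : realType) : {pred R} :=
  fun x => `[< exists k : int, x = (pi *+ 2) *~ k >].

Lemma two_pi_int_zmod_closed (R : realType) : zmod_closed (@two_pi_int R).
Proof.
split=> [|x y /asboolP[k ->] /asboolP[l ->]]; apply/asboolP.
  by exists 0; rewrite mulr0z.
by exists (k - l); rewrite mulrzBr.
Qed.

HB.instance Definition _ (R : realType) :=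
  GRing.isZmodClosed.Build R (@two_pi_int R) (@two_pi_int_zmod_closed R).

Definition torus (R : realType) : zmodType :=
  Quotient.quot (@two_pi_int R : zmodClosed R).

Definition to_torus (R : realType) (x : R) : torus R :=
  \pi_(Quotient.quot (@two_pi_int R : zmodClosed R))%qT x.

Definition of_torus (R : realType) (x : torus R) : R :=
  repr (x : Quotient.quot (@two_pi_int R : zmodClosed R)).

Lemma to_torus_eq (R : realType) (x y : R) :
  to_torus x = to_torus y <-> exists k : int, x = y + (pi *+ 2) *~ k.
Proof.
have E := Quotient.idealrBE (@two_pi_int R : zmodClosed R) x y.
split=> [/eqP|[k xy]].
  rewrite -[X in is_true X]E => /asboolP[k xyk].
  by exists k; rewrite -xyk addrC subrK.
apply/eqP; rewrite -[X in is_true X]E; apply/asboolP.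
by exists k; rewrite xy addrAC subrr add0r.
Qed.

Lemma of_torusK (R : realType) : cancel (@of_torus R) (@to_torus R).
Proof. by move=> x; exact: reprK. Qed.

Definition sin_torus (R : realType) (x : torus R) : R := sin (of_torus x).

Lemma sin_torusE (R : realType) (x : R) : sin_torus (to_torus x) = sin x.
Proof.
have /to_torus_eq[k xk] := of_torusK (to_torus x).
rewrite /sin_torus xk; have P := @sinD2pi R.
case: k {xk} => n; first by rewrite -pmulrn (periodicn P).
by rewrite NegzE mulrNz -pmulrn -[LHS](periodicn P n.+1) subrK.
Qed.

(* Geodesic distance to 0, i.e. the least absolute value of a representative;
   geodesic_abs (x - y) is the distance between x and y. *)
Definition geodesic_abs (R : realType) (x : torus R) : R :=
  inf [set `|r| | r in [set r : R | to_torus r = x]].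

Lemma geodesic_absE (R : realType) (r : R) :
  `|r| <= pi -> geodesic_abs (to_torus r) = `|r|.
Proof.
move=> rpi; apply/eqP; rewrite eq_le; apply/andP; split.
  apply: ge_inf; last by exists r.
  by exists 0 => _ [s _ <-].
apply: lb_le_inf; first by exists `|r|, r.
move=> _ [s /to_torus_eq[k ->] <-].
have [->|k0] := eqVneq k 0; first by rewrite mulr0z addr0.
have k1 : 1 <= `|k%:~R : R| by rewrite -intr_norm ler1z -gtz0_ge1 normr_gt0.
have : pi *+ 2 <= `|(pi *+ 2) *~ k : R|.
  have pi2 : (0 : R) <= pi *+ 2 by rewrite mulrn_wge0// pi_ge0.
  by rewrite -mulrzr normrM (ger0_norm pi2) ler_peMr.
move=> h; have := lerB_normD ((pi *+ 2) *~ k : R) r.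
rewrite [_ + r]addrC; apply: le_trans; rewrite lerBrDr (le_trans _ h)//.
by rewrite mulr2n lerD.
Qed.

Definition torus_dist (R : realType) (N : nat) (x y : 'I_N -> torus R) : R :=
  \big[Num.max/0]_(i < N) geodesic_abs (x i - y i).

Record skeleton (R : realType) (V : finType) (w : V -> V -> R) : Prop := {
  skeleton_ge0 : forall u v, 0 <= w u v;
  skeleton_sym : forall u v, w u v = w v u;
  skeleton_loop : forall u, 0 < w u u;
  skeleton_connected : forall u v, connect (fun a b => 0 < w a b) u v }.

Definition vertex_weight (R : realType) (V : finType) (w : V -> V -> R) (u : V)
  : R := \sum_(v : V) w u v.

Definition jump_prob (R : realType) (V : finType) (w : V -> V -> R) (u v : V)
  : R := w u v / vertex_weight w u.

Definition reversible_measure (R : realType) (V : finType) (w : V -> V -> R)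
  (u : V) : R := vertex_weight w u / \sum_(v : V) vertex_weight w v.

Definition average_weight (R : realType) (V : finType) (w : V -> V -> R) : R :=
  \sum_(u : V) \sum_(v : V)
    w u v * reversible_measure w u * reversible_measure w v.

Definition independent_families d (O : measurableType d) (R : realType)
    (P : probability O R) (I : finType) (F : I -> set (set O)) : Prop :=
  forall (J : {set I}) (E : I -> set O), (forall i, i \in J -> F i (E i)) ->
    P (\bigcap_(i in [set` J]) E i) = (\prod_(i in J) P (E i))%E.

(* S is countable and discrete wherever this is used, hence B ranges over all
   of its subsets. *)
Definition process_sigma (O I S : Type) (D : set I) (X : I -> O -> S)
  : set (set O) :=
  <<s [set X t @^-1` B | t in D & B in [set: set S]] >>.

Record markov_chain d (O : measurableType d) (R : realType)
    (P : probability O R) (V : finType) (p : V -> V -> R) (v0 : V)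
    (Y : nat -> O -> V) : Prop := {
  markov_chain_meas : forall n B, measurable (Y n @^-1` B);
  markov_chain_init : P (Y 0%N @^-1` [set v0]) = 1%E;
  markov_chain_step : forall (n : nat) (v : nat -> V),
    P (\bigcap_(k in `I_n.+2) (Y k @^-1` [set v k])) =
    (P (\bigcap_(k in `I_n.+1) (Y k @^-1` [set v k]))
      * (p (v n) (v n.+1))%:E)%E }.

Record poisson_process d (O : measurableType d) (R : realType)
    (P : probability O R) (rate : R) (M : R -> O -> nat) : Prop := {
  poisson_process_meas : forall t B, 0 <= t -> measurable (M t @^-1` B);
  poisson_process_init : forall o, M 0 o = 0%N;
  poisson_process_mono : forall o s t, 0 <= s -> s <= t ->
    (M s o <= M t o)%N;
  poisson_process_right_cont : forall o t, 0 <= t ->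
    \forall s \near t^'+, M s o = M t o;
  poisson_process_law : forall s t k, 0 <= s -> s < t ->
    P [set o | (M t o - M s o)%N = k] = (poisson_pmf (rate * (t - s)) k)%:E;
  poisson_process_indep : forall (n : nat) (s : nat -> R), 0 <= s 0%N ->
    {homo s : i j / (i <= j)%N >-> i <= j} ->
    independent_families P (fun i : 'I_n =>
      preimage_set_system setT (fun o => (M (s i.+1) o - M (s i) o)%N) setT) }.

(* The walk jumps at the points of a Poisson process M of the given rate, and
   the successive positions form a Markov chain Y independent of M.  A jump
   from u to itself, of probability p u u, is possible. *)
Definition random_walk d (O : measurableType d) (R : realType)
    (P : probability O R) (V : finType) (p : V -> V -> R) (rate : R) (v0 : V)
    (X : R -> O -> V) : Prop :=
  exists (Y : nat -> O -> V) (M : R -> O -> nat),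
    [/\ markov_chain P p v0 Y, poisson_process P rate M,
      independent_families P (fun b : bool =>
        if b then process_sigma [set: nat] Y
        else process_sigma [set t | 0 <= t] M)
    & forall t o, 0 <= t -> X t o = Y (M t o) o].

Record independent_walks d (O : measurableType d) (R : realType)
    (P : probability O R) (V : finType) (w : V -> V -> R) (rate : R) (N : nat)
    (x0 : 'I_N -> V) (X : 'I_N -> R -> O -> V) : Prop := {
  independent_walks_walk : forall i,
    random_walk P (jump_prob w) rate (x0 i) (X i);
  independent_walks_indep :
    independent_families P (fun i => process_sigma [set t | 0 <= t] (X i)) }.

(* A curve in the torus is differentiated through a lift phi to R^N; its
   velocity is a vector of R^N. *)

Definition absolutely_continuous (R : realType) (f : R -> R) (u v : R) : Prop :=
  forall e : R, 0 < e -> exists2 del : R, 0 < del &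
    forall (n : nat) (a b : nat -> R),
      (forall i, (i < n)%N -> [/\ u <= a i, a i <= b i & b i <= v]) ->
      trivIset `I_n (fun i => [set` `]a i, b i[]) ->
      \sum_(i < n) (b i - a i) < del ->
      \sum_(i < n) `|f (b i) - f (a i)| < e.

Definition lift_of (R : realType) (N : nat) (phi : R -> 'I_N -> R)
    (theta : R -> 'I_N -> torus R) : Prop :=
  forall t i, 0 <= t -> theta t i = to_torus (phi t i).

Definition caratheodory_solution (R : realType) (N : nat)
    (F : R -> ('I_N -> torus R) -> 'I_N -> R) (alpha : 'I_N -> torus R)
    (theta : R -> 'I_N -> torus R) : Prop :=
  theta 0 = alpha /\ exists phi : R -> 'I_N -> R,
    [/\ lift_of phi theta,
      forall i t, 0 <= t -> absolutely_continuous (phi ^~ i) 0 t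
    & forall i, {ae @lebesgue_measure R, forall t : R, 0 <= t ->
        is_derive t 1 (phi ^~ i) (F t (theta t) i)}].

(* The derivative is one-sided at t = 0. *)
Definition classical_solution (R : realType) (N : nat)
    (F : R -> ('I_N -> torus R) -> 'I_N -> R) (alpha : 'I_N -> torus R)
    (theta : R -> 'I_N -> torus R) : Prop :=
  theta 0 = alpha /\ exists2 phi : R -> 'I_N -> R,
    lift_of phi theta &
    forall i t, 0 <= t ->
      (phi s i - phi t i) / (s - t)
        @[s --> within [set s | 0 <= s] t^'] --> F t (theta t) i.

Definition kuramoto_field (R : realType) (N : nat) (K : R) (omega : 'I_N -> R)
    (a : 'I_N -> 'I_N -> R) (theta : 'I_N -> torus R) (i : 'I_N) : R :=
  omega i + K / N%:R * \sum_(j < N) a i j * sin_torus (theta j - theta i).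

Definition KRW_field d (O : measurableType d) (R : realType) (V : finType)
    (w : V -> V -> R) (N : nat) (K : R) (omega : 'I_N -> R)
    (X : 'I_N -> R -> O -> V) (o : O) (t : R) : ('I_N -> torus R) -> 'I_N -> R :=
  kuramoto_field K omega (fun i j => w (X i t o) (X j t o)).

Definition averaged_field (R : realType) (V : finType) (w : V -> V -> R)
    (N : nat) (K : R) (omega : 'I_N -> R) (t : R)
  : ('I_N -> torus R) -> 'I_N -> R :=
  kuramoto_field K omega (fun _ _ => average_weight w).

(* Main.v *)
Require Import Defs.
From HB Require Import structures.
From mathcomp Require Import all_boot all_order all_algebra.
From mathcomp Require Import all_classical all_reals all_analysis.
From mathcomp Require Import measurable_realfun.
From mathcomp Require Import ring lra zify.
Set Implicit Arguments.
Unset Strict Implicit.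
Unset Printing Implicit Defensive.
Import Order.TTheory GRing.Theory Num.Theory.
Import numFieldNormedType.Exports.
Local Open Scope classical_set_scope.
Local Open Scope ring_scope.

(* The averaged vector field is Lipschitz, so the two flows are compared by an
   Euler scheme on a grid of mesh del much finer than eps, with a discrete
   Gronwall inequality.  A Caratheodory solution enters only through a mean
   value inequality for absolutely continuous functions, proved by a gauge
   (Cousin) argument.  Besides the mesh, the error has two sources: the cells of
   the grid in which some walk jumps, whose proportion is of order del/eps, and
   the centered sums
     S_k = sum_(l < k) del * (a_ij(X(t_l)) - abar),   i <> j,
   which a summation by parts against the slowly varying
   sin(thetabar_j - thetabar_i) isolates, uniformly in the initial condition.
   The second moment of S_k is small because E[f(Z_s) f(Z_r)] -> 0 as
   (r - s)/eps -> oo for f = a_ij - abar: the number of jumps made in [s, r] is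
   large with high probability and independent of the embedded chains, which
   forget their past by Doeblin's argument.  Everything is a finite sum, and no
   rate of mixing is needed. *)

(** * Mean value inequalities *)

(** The random phases depend on the same walks as the weights, so nothing makes the sines
    independent of the centered weights. Summation by parts avoids the issue: it works path by path
    and needs only small increments of the sines. Probability then enters through two quantities
    built from the walks alone, the partial sums and the number of cells with a jump. Neither sees
    the phases or [alpha], which is why a supremum over [alpha] costs nothing. The restriction to
    distinct indices is forced: a_ii has in general another mean than abar, but its sine is sin 0 =
    0. The order of the choices matters. The grid has [p * q] cells; [p] and the threshold on 1/eps
    come from the second moments, whose bound is the same for all [q]. Only then, with eps given, is
    [q] taken so large that the jumps are harmless. Expectations are compared through an integrable
    majorant of the distance, made of finitely many walk positions and jump events. *)

Lemma cousin_induction (R : realType) (Q : R -> R -> Prop) (a b : R) :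
  a <= b ->
  (forall u v w, u <= v -> v <= w -> Q u v -> Q v w -> Q u w) ->
  (forall x, a <= x <= b -> exists2 e, 0 < e & forall u v,
     a <= u -> u <= x -> x <= v -> v <= b -> x - e < u -> v < x + e -> Q u v) ->
  Q a b.
Proof.
move=> ab Qtrans Qloc.
(* The local hypothesis at the supremum of [S] shows that it is reached and, if it were below [b],
   passed. *)
pose S := [set x | a <= x <= b /\ Q a x].
have Sa : S a.
  split; first by rewrite lexx.
  have [|e e0 Qe] := Qloc a; first by rewrite lexx.
  by apply: Qe => //; rewrite ?ltrBlDr ltrDl.
have supS : has_sup S by split; [exists a | exists b => x [/andP[]]].
have aS : a <= sup S by exact: ub_le_sup supS.2 _ Sa.
have Sb : sup S <= b by apply: ge_sup; [exists a | move=> x [/andP[]]].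
have [|e e0 Qe] := Qloc (sup S); first by rewrite aS.
have [x [/andP[ax xb] Qax] xS] := sup_adherent e0 supS.
have xleS : x <= sup S by apply: ub_le_sup supS.2 _ _; split=> //; rewrite ax.
have Qy y : sup S <= y -> y <= b -> y < sup S + e -> Q a y.
  move=> Sy yb ye; apply: (Qtrans _ x) => //; first exact: le_trans Sy.
  exact: Qe.
have [Sltb|bleS] := ltP (sup S) b; last first.
  have -> : b = sup S by apply/eqP; rewrite eq_le bleS Sb.
  by apply: Qy; rewrite // ltrDl.
pose y := Num.min b (sup S + e / 2).
have Sy : sup S < y by rewrite /y lt_min Sltb ltrDl divr_gt0.
have yb : y <= b by rewrite ge_min lexx.
have : y <= sup S.
  apply: ub_le_sup supS.2 _ _; split.
    by rewrite yb (le_trans aS)// ltW.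
  apply: Qy => //; first exact: ltW.
  by rewrite gt_min ltrD2l gtr_pMr// invf_lt1// ltr1n orbT.
by rewrite leNgt Sy.
Qed.

(** Differentiability with tolerance [B], relative to [[a, b]]: it covers two-sided derivatives and
    the one-sided derivative at time 0 alike. *)
Definition near_linear (R : realType) (f : R -> R) (a b c B x : R) : Prop :=
  forall e, 0 < e -> exists2 del, 0 < del & forall y, a <= y <= b ->
    `|y - x| < del -> `|f y - f x - c * (y - x)| <= (B + e) * `|y - x|.

(** A tag between [u] and [v] makes the lengths of the two one-sided increments add up to [v - u],
    so no constant is lost. *)
Lemma near_linear_straddle (R : realType) (f : R -> R) (a b c B x e : R) :
  near_linear f a b c B x -> 0 < e ->
  exists2 del, 0 < del & forall u v,
    a <= u -> u <= x -> x <= v -> v <= b -> x - del < u -> v < x + del ->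
    `|f v - f u - c * (v - u)| <= (B + e) * (v - u).
Proof.
move=> fx /fx[del del0 fdel]; exists del => // u v au ux xv vb xu vx.
have := fdel v; have := fdel u.
rewrite (ler0_norm (_ : u - x <= 0)) ?subr_le0// (ger0_norm (_ : 0 <= v - x)) ?subr_ge0//.
rewrite au vb (le_trans ux (le_trans xv vb)) (le_trans (le_trans au ux) xv).
move=> /(_ isT) Hu /(_ isT) Hv.
have {}Hu : `|f u - f x - c * (u - x)| <= (B + e) * - (u - x) by apply: Hu; lra.
have {}Hv : `|f v - f x - c * (v - x)| <= (B + e) * (v - x) by apply: Hv; lra.
have -> : f v - f u - c * (v - u) =
  (f v - f x - c * (v - x)) - (f u - f x - c * (u - x)) by ring.
apply: le_trans (ler_normB _ _) _; lra.
Qed.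

Lemma mean_value_near_linear (R : realType) (f : R -> R) (a b c B : R) :
  a <= b -> (forall x, a <= x <= b -> near_linear f a b c B x) ->
  `|f b - f a - c * (b - a)| <= B * (b - a).
Proof.
move=> ab flin; apply/ler_addgt0Pr => e e0.
have [->|anb] := eqVneq a b.
  by rewrite !subrr !mulr0 subrr normr0 add0r ltW.
have ba0 : 0 < b - a by rewrite subr_gt0 lt_neqAle anb.
(* The tolerance is spread in proportion to length, which makes the estimate additive. *)
rewrite -[e](divfK (lt0r_neq0 ba0)) -mulrDl.
apply: (@cousin_induction R (fun u v =>
  `|f v - f u - c * (v - u)| <= (B + e / (b - a)) * (v - u))) => //.
  move=> u v w uv vw Huv Hvw.
  have -> : f w - f u - c * (w - u) =
    (f v - f u - c * (v - u)) + (f w - f v - c * (w - v)) by ring.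
  apply: le_trans (ler_normD _ _) _; lra.
by move=> x /flin fx; apply: near_linear_straddle fx _; rewrite divr_gt0.
Qed.

(** Passes from an ordered list of intervals, convenient for concatenation, to the indexed disjoint
    family that [absolutely_continuous] expects. *)
Lemma sum_lengths_le (R : realType) (U : set R) (s : seq (R * R)) :
  measurable U -> all (fun p => p.1 <= p.2) s ->
  pairwise (fun p q => p.2 <= q.1) s ->
  (forall p, p \in s -> [set` `]p.1, p.2[] `<=` U) ->
  ((\sum_(p <- s) (p.2 - p.1))%:E <= lebesgue_measure U)%E /\
  trivIset `I_(size s) (fun i => [set` `](nth (0, 0) s i).1, (nth (0, 0) s i).2[]).
Proof.
move=> mU /allP s12 sp sU; set F := fun i => [set` _].
have tF : trivIset `I_(size s) F.
  have disj i j : (i < size s)%N -> (j < size s)%N -> (i < j)%N ->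
      F i `&` F j = set0.
    move=> ilt jlt ij; apply/seteqP; split=> // x [].
    rewrite /F/= !in_itv/= => /andP[_ xi] /andP[xj _].
    have := elimT (pairwiseP (0, 0)) sp i j ilt jlt ij.
    by rewrite leNgt (lt_trans xj xi).
  apply/trivIsetP => i j /= ilt jlt.
  rewrite neq_ltn => /orP[ij|ij]; first by apply: disj.
  by rewrite setIC; exact: disj.
split=> //.
have mF i : measurable (F i) by exact: measurable_itv.
have mB : measurable (\big[setU/set0]_(i < size s) F i) by exact: bigsetU_measurable.
apply: (@le_trans _ _ (lebesgue_measure (\big[setU/set0]_(i < size s) F i))); last first.
  apply: le_measure; rewrite ?inE //.
  rewrite -(bigcup_mkord (size s) F) => x [i /= ilt]; apply: sU.
  exact: mem_nth.
rewrite measure_semi_additive_ord_I//; last by move=> k _; exact: mF.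
rewrite (big_nth (0, 0)) big_mkord -sumEFin; apply: lee_sum => i _.
rewrite [leRHS]lebesgue_measure_itv/= lte_fin.
have /s12 : nth (0, 0) s i \in s by exact: mem_nth.
rewrite le_eqVlt => /orP[/eqP->|->]; last by [].
by rewrite ltxx subrr.
Qed.

(* Off the null set E the increments are controlled by near-linearity; the
   points of E are tagged by intervals inside an open set of small measure, on
   which absolute continuity makes the increments negligible. *)
Lemma mean_value_absolutely_continuous (R : realType) (f : R -> R)
    (a b c B : R) (E : set R) :
  a <= b -> 0 <= B -> absolutely_continuous f a b ->
  (@lebesgue_measure R).-negligible E ->
  (forall x, a <= x <= b -> ~ E x -> near_linear f a b c B x) ->
  `|f b - f a - c * (b - a)| <= B * (b - a).
Proof.
move=> ab B0 fac [A [mA A0 EA]] flin; apply/ler_addgt0Pr => e0 e00.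
(* Three errors share [e0]: [e * (b - a)] from near-linearity, [e] from the increments over the
   intervals tagged in the null set, [|c| * e] from their lengths. *)
pose e := e0 / (b - a + 1 + `|c|).
have den : 0 < b - a + 1 + `|c| by have := normr_ge0 c; lra.
have e_gt0 : 0 < e by rewrite divr_gt0.
have [del del0 fdel] := fac e e_gt0.
have me : 0 < Num.min del e by rewrite lt_min del0.
have [U [oU AU UA]] := lebesgue_regularity_outer mA
  (eq_ind_r (fun z => (z < +oo)%E) (ltry _) A0) me.
have mU : measurable U by exact: open_measurable.
have Ue : (lebesgue_measure U < (Num.min del e)%:E)%E.
  have UA0 : lebesgue_measure (U `&` A) = 0%E.
    by apply: subset_measure0 A0 => //; exact: measurableI.
  by rewrite (measureDI lebesgue_measure mU mA) [X in (_ + X)%E](_ : _ = 0%E) ?adde0.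
(* [s] lists the intervals tagged in the null set, and the last term is the error they are allowed.
   Lists concatenate, so [Q] is additive. *)
pose Q u v := exists s : seq (R * R), [/\
  all (fun p => [&& p.1 <= p.2, u <= p.1 & p.2 <= v]) s,
  (forall p, p \in s -> [set` `]p.1, p.2[] `<=` U),
  pairwise (fun p q => p.2 <= q.1) s &
  `|f v - f u - c * (v - u)| <= (B + e) * (v - u) +
    (\sum_(p <- s) `|f p.2 - f p.1| + `|c| * \sum_(p <- s) (p.2 - p.1))].
have : Q a b.
  apply: cousin_induction => // [u v w uv vw|x xab].
    move=> [s [/allP s1 s2 s3 s4]] [t [/allP t1 t2 t3 t4]]; exists (s ++ t); split.
    - rewrite all_cat; apply/andP; split; apply/allP => p.
        by move=> /s1/and3P[-> -> /= /le_trans->].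
      by move=> /t1/and3P[-> h ->]; rewrite (le_trans uv).
    - by move=> p; rewrite mem_cat => /orP[/s2|/t2].
    - rewrite pairwise_cat s3 t3 !andbT; apply/allrelP => p q.
      by move=> /s1/and3P[_ _ pv] /t1/and3P[_ vq _]; apply: le_trans vq.
    - rewrite !big_cat/=.
      have -> : f w - f u - c * (w - u) =
        (f v - f u - c * (v - u)) + (f w - f v - c * (w - v)) by ring.
      apply: le_trans (ler_normD _ _) _; apply: le_trans (lerD s4 t4) _.
      by rewrite le_eqVlt; apply/orP; left; apply/eqP; ring.
  have [Ax|nAx] := pselect (A x); last first.
    have [|del' del'0 fdel'] := near_linear_straddle (flin _ xab _) e_gt0.
      by move/EA.
    exists del' => // u v au ux xv vb xu vx; exists [::]; split=> //.
    by rewrite !big_nil mulr0 !addr0; apply: fdel'.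
  have /nbhs_ballP[r /= r0 xrU] : nbhs x U by apply: open_nbhs_nbhs; split=> //; exact: AU.
  exists r => // u v au ux xv vb xu vx; exists [:: (u, v)]; split=> //=.
  - by rewrite !lexx (le_trans ux).
  - move=> p; rewrite inE => /eqP -> y /=; rewrite in_itv/= => /andP[uy yv].
    by apply: xrU; rewrite /ball/= ltr_norml; apply/andP; split; lra.
  - rewrite !big_seq1/=; apply: le_trans (ler_normB _ _) _.
    rewrite normrM (ger0_norm (_ : 0 <= v - u)) ?subr_ge0 ?(le_trans ux)//.
    by rewrite lerDr mulr_ge0// ?subr_ge0 ?(le_trans ux)// addr_ge0// ltW.
move=> [s [/allP s1 s2 s3 s4]].
have s12 : all (fun p => p.1 <= p.2) s by apply/allP => p /s1/and3P[].
have [lens tris] := sum_lengths_le mU s12 s3 s2.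
have {lens}lens : \sum_(p <- s) (p.2 - p.1) < Num.min del e.
  by rewrite -lte_fin; apply: le_lt_trans lens Ue.
have sumf : \sum_(p <- s) `|f p.2 - f p.1| < e.
  rewrite (big_nth (0, 0)) big_mkord.
  apply: (fdel _ (fun i => (nth (0, 0) s i).1) (fun i => (nth (0, 0) s i).2)) => //.
    by move=> i ilt; have /s1/and3P[] : nth (0, 0) s i \in s by exact: mem_nth.
  by move: lens; rewrite (big_nth (0, 0)) big_mkord lt_min => /andP[].
move: lens; rewrite lt_min => /andP[_ lense].
apply: le_trans s4 _.
have := ler_wpM2l (normr_ge0 c) (ltW lense).
have -> : B * (b - a) + e0 = B * (b - a) + e * (b - a + 1 + `|c|).
  by rewrite /e divfK// lt0r_neq0.
lra.
Qed.

(** * Summation by parts and discrete Gronwall inequality *)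

Lemma abel_summation (R : realType) (d g : nat -> R) (k : nat) :
  \sum_(l < k) d l * g l = (\sum_(l < k) d l) * g k -
    \sum_(l < k) (\sum_(m < l.+1) d m) * (g l.+1 - g l).
Proof.
elim: k => [|k IH]; first by rewrite !big_ord0 mul0r subr0.
by rewrite !big_ord_recr/= IH; ring.
Qed.

(** Only the partial sums of [d] need be small: summation by parts pays [S] once for the last value
    of [g] and [S * L] for each increment. *)
Lemma norm_sum_abel (R : realType) (d g : nat -> R) (k : nat) (S L : R) :
  (forall l, `|g l| <= 1) -> (forall l, (l < k)%N -> `|g l.+1 - g l| <= L) ->
  (forall m, (m <= k)%N -> `|\sum_(l < m) d l| <= S) ->
  `|\sum_(l < k) d l * g l| <= S * (1 + k%:R * L).
Proof.
move=> g1 gL dS; rewrite abel_summation (le_trans (ler_normB _ _))// mulrDr mulr1.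
apply: lerD; first by rewrite normrM -[leRHS]mulr1 ler_pM ?dS.
apply: le_trans (ler_norm_sum _ _ _) _.
have -> : S * (k%:R * L) = \sum_(l < k) S * L.
  by rewrite sumr_const card_ord -mulr_natl; ring.
by apply: ler_sum => l _; rewrite normrM ler_pM ?gL ?dS.
Qed.

(** [E * (1 + c) ^+ k] solves the recursion with equality. The hypothesis grants the earlier bounds
    at every index of [I], because each oscillator is driven by the errors of all the others. *)
Lemma discrete_gronwall (R : realType) (I : Type) (u : nat -> I -> R) (E c : R)
    (n : nat) :
  0 <= E -> 0 <= c ->
  (forall k i, (k <= n)%N ->
    (forall l j, (l < k)%N -> u l j <= E * (1 + c) ^+ l) ->
    u k i <= E + \sum_(l < k) c * (E * (1 + c) ^+ l)) ->
  forall k i, (k <= n)%N -> u k i <= E * expR (c * n%:R).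
Proof.
move=> E0 c0 H k i kn.
have sumE m : E + \sum_(l < m) c * (E * (1 + c) ^+ l) = E * (1 + c) ^+ m.
  elim: m => [|m IH]; first by rewrite big_ord0 addr0 expr0 mulr1.
  by rewrite big_ord_recr/= addrA IH exprS; ring.
have {}H m j : (m <= n)%N -> u m j <= E * (1 + c) ^+ m.
  elim/ltn_ind: m j => m IH j mn; rewrite -sumE; apply: H => // l {}j lm.
  by apply: IH => //; apply: leq_trans (ltnW lm) mn.
apply: le_trans (H _ _ kn) _; rewrite ler_wpM2l// mulrC.
rewrite expRM_natl.
have c1 : 0 <= 1 + c by rewrite addr_ge0.
apply: (@le_trans _ _ ((1 + c) ^+ n)).
  by rewrite ler_weXn2l// lerDl.
by rewrite lerXn2r ?nnegrE ?expR_ge0// expR_ge1Dx.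
Qed.

(** * Near-linearity from derivatives *)

Lemma is_derive_near_linear (R : realType) (f : R -> R) (a b c B x l : R) :
  is_derive x 1 f l -> `|l - c| <= B -> near_linear f a b c B x.
Proof.
move=> [/cvg_ex[l' /= fl'] fl] lcB e e0.
have l'E : l' = l by rewrite -fl; apply/esym/cvg_lim.
rewrite {}l'E {l' fl} in fl'.
have /cvgrPdist_le/(_ e e0) := fl'.
rewrite near_withinE => /nbhs_ballP[del /= del0 H]; exists del => // y _ yx.
have [->|ynx] := eqVneq y x; first by rewrite !subrr !mulr0 subr0 normr0 mulr0.
have {}yx0 : y - x != 0 by rewrite subr_eq0.
have := H (y - x); rewrite /ball/= sub0r normrN => /(_ yx yx0).
rewrite /GRing.scale/= mulr1 subrK => H1.
have -> : f y - f x - c * (y - x) =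
    ((l - c) - (l - (y - x)^-1 * (f y - f x))) * (y - x).
  by field.
rewrite normrM ler_wpM2r// (le_trans (ler_normB _ _))// lerD//.
Qed.

Lemma sin_lipschitz (R : realType) (x y : R) : `|sin x - sin y| <= `|x - y|.
Proof.
wlog xy : x y / y <= x => [H|].
  have [/H//|/ltW/H] := leP y x.
  by rewrite distrC (distrC x y).
rewrite (ger0_norm (_ : 0 <= x - y)) ?subr_ge0//.
have := @mean_value_near_linear R sin y x 0 1 xy.
rewrite mul0r subr0 mul1r; apply=> z _.
apply: (@is_derive_near_linear _ _ _ _ _ _ _ (cos z)).
by rewrite subr0 ler_norml cos_geN1 cos_le1.
Qed.

(** Since [0 <= a], every point of [[a, b]] lies in the half-line along which the limit is taken. *)
Lemma difference_quotient_near_linear (R : realType) (f : R -> R)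
    (a b c B x l : R) :
  0 <= a -> (f s - f x) / (s - x) @[s --> within [set s | 0 <= s] x^'] --> l ->
  `|l - c| <= B -> near_linear f a b c B x.
Proof.
move=> a0 fl lcB e e0.
have /cvgrPdist_le/(_ e e0) := fl.
rewrite !near_withinE => /nbhs_ballP[del /= del0 H]; exists del => // y /andP[ay _] yx.
have [->|ynx] := eqVneq y x; first by rewrite !subrr !mulr0 subr0 normr0 mulr0.
have yx0 : y - x != 0 by rewrite subr_eq0.
have := H y; rewrite /ball/= distrC => /(_ yx ynx (le_trans a0 ay)) H1.
have -> : f y - f x - c * (y - x) =
    ((l - c) - (l - (f y - f x) / (y - x))) * (y - x).
  by field.
rewrite normrM ler_wpM2r// (le_trans (ler_normB _ _))// lerD//.
Qed.

Lemma to_torusB (R : realType) (x y : R) :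
  to_torus (x - y) = to_torus x - to_torus y.
Proof.
rewrite /to_torus.
by rewrite [LHS]raddfB.
Qed.

(** * Comparison of the two flows *)

Lemma norm_mean_le (R : realType) (N : nat) (K M : R) (c : 'I_N -> R) :
  (0 < N)%N -> 0 <= K -> (forall j, `|c j| <= M) ->
  `|K / N%:R * \sum_j c j| <= K * M.
Proof.
move=> N0 K0 cM; have N0R : (0 : R) < N%:R by rewrite ltr0n.
rewrite normrM ger0_norm ?divr_ge0// -mulrA ler_wpM2l// mulrC ler_pdivrMr//.
apply: le_trans (ler_norm_sum _ _ _) _.
apply: le_trans (ler_sum _ (fun j _ => cM j)) _.
by rewrite sumr_const card_ord mulr_natr.
Qed.

(** The Kuramoto field read on a lift, where phases are reals and Lipschitz bounds make sense. *)
Definition drift (R : realType) (N : nat) (K : R) (omega : 'I_N -> R)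
    (a : 'I_N -> 'I_N -> R) (phi : 'I_N -> R) (i : 'I_N) : R :=
  omega i + K / N%:R * \sum_(j < N) a i j * sin (phi j - phi i).

Lemma kuramoto_field_lift (R : realType) (N : nat) (K : R) (omega : 'I_N -> R)
    (a : 'I_N -> 'I_N -> R) (theta : 'I_N -> torus R) (phi : 'I_N -> R)
    (i : 'I_N) :
  (forall j, theta j = to_torus (phi j)) ->
  kuramoto_field K omega a theta i = drift K omega a phi i.
Proof.
move=> tp; rewrite /kuramoto_field /drift; congr (_ + _ * _).
by apply: eq_bigr => j _; rewrite !tp -to_torusB sin_torusE.
Qed.

Lemma norm_sin_le1 (R : realType) (x : R) : `|sin x| <= 1.
Proof. by rewrite ler_norml sin_geN1 sin_le1. Qed.

Lemma norm_drift_le (R : realType) (N : nat) (K A : R) (omega : 'I_N -> R)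
    (a : 'I_N -> 'I_N -> R) (phi : 'I_N -> R) (i : 'I_N) :
  0 <= K -> (forall j, `|a i j| <= A) ->
  `|drift K omega a phi i| <= \sum_j `|omega j| + K * A.
Proof.
move=> K0 aA; apply: le_trans (ler_normD _ _) _; apply: lerD.
  by rewrite (bigD1 i)//= lerDl sumr_ge0.
apply: norm_mean_le => // [|j]; first exact: leq_ltn_trans (ltn_ord i).
by rewrite normrM -[leRHS]mulr1 ler_pM// norm_sin_le1.
Qed.

Lemma drift_lipschitz (R : realType) (N : nat) (K A r : R) (omega : 'I_N -> R)
    (a : 'I_N -> 'I_N -> R) (phi psi : 'I_N -> R) (i : 'I_N) :
  0 <= K -> (forall j, `|a i j| <= A) -> (forall j, `|phi j - psi j| <= r) ->
  `|drift K omega a phi i - drift K omega a psi i| <= K * (A * (2 * r)).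
Proof.
move=> K0 aA pr; rewrite /drift opprD addrACA subrr add0r -mulrBr -sumrB.
apply: norm_mean_le => // [|j]; first exact: leq_ltn_trans (ltn_ord i).
rewrite -mulrBr normrM ler_pM//; apply: le_trans (sin_lipschitz _ _) _.
have -> : phi j - phi i - (psi j - psi i) = (phi j - psi j) - (phi i - psi i).
  by ring.
by rewrite (le_trans (ler_normB _ _))// mulr2n mulrDl mul1r lerD.
Qed.

(** Serves the cells with a jump: the weights are not comparable there, but [omega] cancels and each
    coupling term is at most [K * A]. *)
Lemma drift_weights_bound (R : realType) (N : nat) (K A : R)
    (omega : 'I_N -> R) (a b : 'I_N -> 'I_N -> R) (phi psi : 'I_N -> R)
    (i : 'I_N) :
  0 <= K -> (forall j, `|a i j| <= A) -> (forall j, `|b i j| <= A) ->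
  `|drift K omega a phi i - drift K omega b psi i| <= 2 * (K * A).
Proof.
move=> K0 aA bA; rewrite /drift opprD addrACA subrr add0r.
apply: le_trans (ler_normB _ _) _; rewrite mulr2n mulrDl mul1r.
have N0 : (0 < N)%N by exact: leq_ltn_trans (ltn_ord i).
by apply: lerD; apply: norm_mean_le => // j; rewrite normrM -[leRHS]mulr1;
  rewrite ler_pM// norm_sin_le1.
Qed.

(** The term with [S] comes from summation by parts, [2 * (B * del)] being the change of y_j - y_i
    in one step; the term with [C] sums the one-step errors of both schemes; the Lipschitz constant
    [K * (A * 2)] feeds the exponential. *)
Lemma euler_scheme_comparison (R : realType) (N : nat)
    (K A B C del S abar : R) (n : nat) (omega : 'I_N -> R)
    (a : nat -> 'I_N -> 'I_N -> R) (x y : nat -> 'I_N -> R) (jump : nat -> R) :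
  0 <= K -> 0 <= A -> 0 <= B -> 0 <= C -> 0 <= del -> 0 <= S ->
  (forall k, 0 <= jump k) ->
  (forall k i j, `|a k i j| <= A) -> x 0%N =1 y 0%N ->
  (forall k i, (k < n)%N ->
    `|x k.+1 i - x k i - del * drift K omega (a k) (x k) i|
      <= del * (C * (del + jump k))) ->
  (forall k i, (k < n)%N ->
    `|y k.+1 i - y k i - del * drift K omega (fun _ _ => abar) (y k) i|
      <= del * (C * del)) ->
  (forall k i, (k < n)%N -> `|y k.+1 i - y k i| <= B * del) ->
  (forall i j m, i != j -> (m <= n)%N ->
    `|\sum_(l < m) del * (a l i j - abar)| <= S) ->
  forall k i, (k <= n)%N -> `|x k i - y k i| <=
    (K * (S * (1 + n%:R * (2 * (B * del)))) +
     del * C * (2 * (n%:R * del) + \sum_(l < n) jump l)) *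
    expR ((K * (A * 2)) * del * n%:R).
Proof.
move=> K0 A0 B0 C0 del0 S0 jump0 aA xy0 xstep ystep yB aS.
set E := K * _ + _.
have E0 : 0 <= E.
  by rewrite addr_ge0 ?mulr_ge0 ?addr_ge0 ?mulr_ge0 ?sumr_ge0 ?ler0n.
apply: (@discrete_gronwall _ _ (fun k i => `|x k i - y k i|)) => //.
  by rewrite !mulr_ge0.
move=> k i kn IH.
have N0 : (0 < N)%N by exact: leq_ltn_trans (ltn_ord i).
pose F l := drift K omega (a l).
pose r l := (x l.+1 i - x l i - del * F l (x l) i) -
  (y l.+1 i - y l i - del * drift K omega (fun _ _ => abar) (y l) i).
(* One-step errors, a Lipschitz term with the true weights, and the effect of [a - abar] along [y],
   left to summation by parts. *)
have decomp m : x m i - y m i = \sum_(l < m) r l +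
    \sum_(l < m) del * (F l (x l) i - F l (y l) i) +
    K / N%:R * \sum_j \sum_(l < m)
      del * (a l i j - abar) * sin (y l j - y l i).
  rewrite exchange_big/= mulr_sumr -!big_split/=.
  elim: m => [|m IHm]; first by rewrite big_ord0 xy0 subrr.
  rewrite big_ord_recr/= -IHm /r.
  have -> : K / N%:R * \sum_j del * (a m i j - abar) * sin (y m j - y m i) =
      del * (F m (y m) i - drift K omega (fun _ _ => abar) (y m) i).
    rewrite /F /drift opprD addrACA subrr add0r -mulrBr -sumrB mulrCA.
    congr (_ * _); rewrite mulr_sumr; apply: eq_bigr => j _.
    by ring.
  by ring.
rewrite decomp; apply: le_trans (ler_normD _ _) _.
apply: (@le_trans _ _ (del * C * (2 * (n%:R * del) + \sum_(l < n) jump l) +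
   \sum_(l < k) (K * (A * 2)) * del * (E * (1 + (K * (A * 2)) * del) ^+ l) +
   K * (S * (1 + n%:R * (2 * (B * del)))))); last first.
  by rewrite [leRHS]addrAC /E; lra.
apply: lerD; last first.
  apply: norm_mean_le => // j.
  (* On the diagonal the sine vanishes, which is why [aS] speaks of [i != j]. *)
  have [<-|ij] := eqVneq i j.
    rewrite big1 ?normr0 => [|l _]; last by rewrite subrr sin0 mulr0.
    by rewrite mulr_ge0// addr_ge0// !mulr_ge0.
  apply: (le_trans (@norm_sum_abel R (fun l => del * (a l i j - abar))
    (fun l => sin (y l j - y l i)) k S (2 * (B * del)) _ _ _)).
  - by move=> l; exact: norm_sin_le1.
  - move=> l lk; apply: le_trans (sin_lipschitz _ _) _.
    have -> : y l.+1 j - y l.+1 i - (y l j - y l i) =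
      (y l.+1 j - y l j) - (y l.+1 i - y l i) by ring.
    rewrite (le_trans (ler_normB _ _))// mulr2n mulrDl mul1r.
    by rewrite lerD// yB// (leq_trans lk).
  - by move=> m mk; apply: aS => //; apply: leq_trans kn.
  - rewrite ler_wpM2l// lerD2l ler_wpM2r ?mulr_ge0//.
    by rewrite ler_nat.
apply: le_trans (ler_normD _ _) _; apply: lerD.
  apply: le_trans (ler_norm_sum _ _ _) _.
  apply: (@le_trans _ _ (\sum_(l < n) del * C * (2 * del + jump l))).
    rewrite (big_ord_widen n (fun l => `|r l|) kn) big_mkcond/=.
    apply: ler_sum => l _; case: ifP => [_|_].
      apply: le_trans (ler_normB _ _) _.
      have := xstep l i (ltn_ord l); have := ystep l i (ltn_ord l).
      rewrite -/(F l) => h1 h2; apply: le_trans (lerD h2 h1) _.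
      by rewrite le_eqVlt; apply/orP; left; apply/eqP; ring.
    by rewrite !mulr_ge0// addr_ge0// mulr_ge0.
  rewrite -mulr_sumr big_split/= sumr_const card_ord -mulr_natl.
  by rewrite le_eqVlt; apply/orP; left; apply/eqP; ring.
apply: le_trans (ler_norm_sum _ _ _) _; apply: ler_sum => l _.
rewrite normrM ger0_norm//.
have -> : K * (A * 2) * del * (E * (1 + K * (A * 2) * del) ^+ l) =
  del * (K * (A * (2 * (E * (1 + K * (A * 2) * del) ^+ l)))) by ring.
rewrite ler_wpM2l//; apply: drift_lipschitz => // j.
by apply: IH.
Qed.

Lemma geodesic_abs_le (R : realType) (r : R) : geodesic_abs (to_torus r) <= `|r|.
Proof. by apply: ge_inf; [exists 0 => _ [s _ <-] | exists r]. Qed.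

Lemma torus_dist_lift_le (R : realType) (N : nat) (theta eta : 'I_N -> torus R)
    (phi psi : 'I_N -> R) (r : R) :
  (forall i, theta i = to_torus (phi i)) ->
  (forall i, eta i = to_torus (psi i)) -> 0 <= r ->
  (forall i, `|phi i - psi i| <= r) -> torus_dist theta eta <= r.
Proof.
move=> tp ep r0 H; rewrite /torus_dist.
elim/big_ind : _ => //= [x y xr yr|i _]; first by rewrite ge_max xr.
by rewrite tp ep -to_torusB (le_trans (geodesic_abs_le _)).
Qed.

Lemma torus_dist_ge0 (R : realType) (N : nat) (theta eta : 'I_N -> torus R) :
  0 <= torus_dist theta eta.
Proof.
rewrite /torus_dist; elim/big_ind : _ => //= [x y x0 y0|i _].
  by rewrite le_max x0.
by apply: lb_le_inf; [exists `|of_torus (theta i - eta i)|;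
  exists (of_torus (theta i - eta i)) => //; exact: of_torusK | move=> _ [s _ <-]].
Qed.

(** The common interface of the two notions of solution: all that the comparison takes from a
    differential equation. *)
Definition mean_value_lift (R : realType) (N : nat)
    (F : R -> ('I_N -> torus R) -> 'I_N -> R)
    (theta : R -> 'I_N -> torus R) (phi : R -> 'I_N -> R) : Prop :=
  lift_of phi theta /\ forall i s t c B, 0 <= s -> s <= t -> 0 <= B ->
    (forall tau, s <= tau <= t -> `|F tau (theta tau) i - c| <= B) ->
    `|phi t i - phi s i - c * (t - s)| <= B * (t - s).

Lemma caratheodory_mean_value (R : realType) (N : nat)
    (F : R -> ('I_N -> torus R) -> 'I_N -> R) (alpha : 'I_N -> torus R)
    (theta : R -> 'I_N -> torus R) :
  caratheodory_solution F alpha theta ->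
  exists phi, mean_value_lift F theta phi.
Proof.
move=> [_ [phi [lphi ac der]]]; exists phi; split=> // i s t c B s0 st B0 FB.
apply: (@mean_value_absolutely_continuous R (phi^~ i) s t c B _ st B0 _ (der i)).
  move=> e e0; have [del del0 H] := ac i t (le_trans s0 st) e e0.
  exists del => // m a b ab; apply: H => j /ab[sa aj bt]; split=> //.
  exact: le_trans sa.
(* Being off the exceptional set of [der i] unfolds to the derivative at [x]. *)
move=> x xst /contrapT/=/(_ _)/wrap[].
  by rewrite (le_trans s0)//; case/andP: xst.
by move=> dphi; apply: is_derive_near_linear dphi _; apply: FB.
Qed.

(** Subtracting [phi 0 i - phi0 i], a multiple of 2 pi, leaves a lift. The two flows can then be
    compared in R^N from the same point. *)
Lemma classical_mean_value (R : realType) (N : nat)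
    (F : R -> ('I_N -> torus R) -> 'I_N -> R) (alpha : 'I_N -> torus R)
    (theta : R -> 'I_N -> torus R) (phi0 : 'I_N -> R) :
  classical_solution F alpha theta -> (forall i, alpha i = to_torus (phi0 i)) ->
  exists2 phi, mean_value_lift F theta phi & phi 0 =1 phi0.
Proof.
move=> [theta0 [phi lphi der]] alpha0.
exists (fun t i => phi t i - (phi 0 i - phi0 i)); last by move=> i; ring.
split=> [t i t0|i s t c B s0 st B0 FB].
  by rewrite to_torusB to_torusB -!lphi// -alpha0 theta0 subrr subr0.
have -> : phi t i - (phi 0 i - phi0 i) - (phi s i - (phi 0 i - phi0 i)) =
  phi t i - phi s i by ring.
apply: (@mean_value_near_linear R (phi^~ i) s t c B) => // x xst.
have x0 : 0 <= x by rewrite (le_trans s0)//; case/andP: xst.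
exact: (@difference_quotient_near_linear R (phi^~ i) s t c B x _ s0
  (der i x x0) (FB x xst)).
Qed.

(** Purely deterministic: [a] is one realization of the weights. The last term, [2 * (B * del)], is
    the cost of moving both flows from the grid point below [t] to [t]. *)
Lemma averaging_pathwise (R : realType) (N : nat) (K A abar T S : R) (n : nat)
    (omega : 'I_N -> R) (a : R -> 'I_N -> 'I_N -> R) (alpha : 'I_N -> torus R)
    (theta thetabar : R -> 'I_N -> torus R) (jump : nat -> bool)
    (B := \sum_j `|omega j| + K * A) (del := T / n%:R) :
  0 <= K -> 0 <= A -> 0 < T -> (0 < n)%N -> 0 <= S ->
  (forall t i j, `|a t i j| <= A) -> `|abar| <= A ->
  caratheodory_solution (fun t => kuramoto_field K omega (a t)) alpha theta ->
  classical_solution (fun=> kuramoto_field K omega (fun _ _ => abar))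
    alpha thetabar ->
  (forall k t, (k < n)%N -> ~~ jump k -> k%:R * del <= t <= k.+1%:R * del ->
    a t = a (k%:R * del)) ->
  (forall i j m, i != j -> (m <= n)%N ->
    `|\sum_(l < m) del * (a (l%:R * del) i j - abar)| <= S) ->
  forall t, 0 <= t <= T -> torus_dist (theta t) (thetabar t) <=
    (K * (S * (1 + 2 * (B * T))) +
      (K * (A * (2 * B)) + 2 * (K * A)) *
        (2 * T * del + del * \sum_(l < n) (jump l)%:R)) *
    expR (K * (A * 2) * T) + 2 * (B * del).
Proof.
move=> K0 A0 T0 n0 S0 aA abarA sol solbar ajump aS t /andP[t0 tT].
have n0R : (0 : R) < n%:R by rewrite ltr0n.
have del0 : 0 < del by rewrite divr_gt0.
have ndel : n%:R * del = T by rewrite mulrC divfK// lt0r_neq0.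
have B0 : 0 <= B by rewrite addr_ge0 ?sumr_ge0// mulr_ge0.
have [phi [lphi phiP]] := caratheodory_mean_value sol.
have alphaE i : alpha i = to_torus (phi 0 i) by rewrite -lphi//; case: sol => <-.
have [psi [lpsi psiP] psi0] := classical_mean_value solbar alphaE.
have fphi s i : 0 <= s ->
    kuramoto_field K omega (a s) (theta s) i = drift K omega (a s) (phi s) i.
  by move=> s0; apply: kuramoto_field_lift => j; exact: lphi.
have fpsi s i : 0 <= s ->
    kuramoto_field K omega (fun _ _ => abar) (thetabar s) i =
    drift K omega (fun _ _ => abar) (psi s) i.
  by move=> s0; apply: kuramoto_field_lift => j; exact: lpsi.
have phiL i s u : 0 <= s -> s <= u -> `|phi u i - phi s i| <= B * (u - s).
  move=> s0 su; have := phiP i s u 0 B s0 su B0; rewrite mul0r subr0; apply.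
  move=> x /andP[sx _]; rewrite subr0 fphi ?(le_trans s0)//.
  exact: norm_drift_le.
have psiL i s u : 0 <= s -> s <= u -> `|psi u i - psi s i| <= B * (u - s).
  move=> s0 su; have := psiP i s u 0 B s0 su B0; rewrite mul0r subr0; apply.
  move=> x /andP[sx _]; rewrite subr0 fpsi ?(le_trans s0)//.
  by apply: norm_drift_le.
(* One constant for both kinds of cell: the first summand, times [del], bounds the variation of the
   drift where the weights are frozen; the second bounds the effect of a jump. *)
pose C := K * (A * (2 * B)) + 2 * (K * A).
have C0 : 0 <= C by rewrite addr_ge0// !mulr_ge0.
have C2 : K * (A * (2 * (B * del))) <= C * del.
  have -> : C * del = K * (A * (2 * (B * del))) + 2 * (K * A) * del.
    by rewrite /C; ring.
  by rewrite lerDl !mulr_ge0// ltW.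
have grid0 k : 0 <= k%:R * del by rewrite mulr_ge0// ltW.
have gridS k : k.+1%:R * del - k%:R * del = del by rewrite -natr1; ring.
have grid1 k : k.+1%:R * del = del + k%:R * del by rewrite -natr1; ring.
have gridW k : k%:R * del <= k.+1%:R * del by rewrite -subr_ge0 gridS ltW.
have main k i : (k <= n)%N -> `|phi (k%:R * del) i - psi (k%:R * del) i| <=
    (K * (S * (1 + n%:R * (2 * (B * del)))) +
     del * C * (2 * (n%:R * del) + \sum_(l < n) (jump l)%:R)) *
    expR ((K * (A * 2)) * del * n%:R).
  apply: (@euler_scheme_comparison R N K A B C del S abar n omega
    (fun k => a (k%:R * del)) (fun k => phi (k%:R * del))
    (fun k => psi (k%:R * del)) (fun k => (jump k)%:R)) => //.
  - exact: ltW.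
  - by move=> j; rewrite !mul0r psi0.
  - move=> {}k {}i kn; pose D := drift K omega (a (k%:R * del)) (phi (k%:R * del)) i.
    rewrite -/D (mulrC _ D) (mulrC _ (C * (del + (jump k)%:R))).
    have := phiP i (k%:R * del) (k.+1%:R * del) D (C * (del + (jump k)%:R)).
    rewrite gridS; apply => //.
      by rewrite mulr_ge0// addr_ge0// ltW.
    move=> x /andP[kx xk]; rewrite fphi ?(le_trans _ kx)//.
    case jk : (jump k).
      apply: (le_trans (@drift_weights_bound R N K A omega _ _ _ _ i K0 (aA _ _) (aA _ _))).
      have C1 : 2 * (K * A) <= C by rewrite lerDr !mulr_ge0.
      by rewrite mulrDr mulr1 (le_trans C1)// lerDr mulr_ge0// ltW.
    rewrite (ajump k x) ?jk ?kx//.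
    apply: le_trans (@drift_lipschitz R N K A (B * del) omega _ _ _ i K0 (aA _ _) _) _.
      move=> j; apply: le_trans (phiL _ _ _ (grid0 k) kx) _.
      by rewrite ler_wpM2l// lerBlDr -grid1.
    rewrite addr0; exact: C2.
  - move=> {}k {}i kn; pose D := drift K omega (fun _ _ => abar) (psi (k%:R * del)) i.
    rewrite -/D (mulrC _ D) (mulrC _ (C * del)).
    have := psiP i (k%:R * del) (k.+1%:R * del) D (C * del).
    rewrite gridS; apply => //.
      by rewrite mulr_ge0// ltW.
    move=> x /andP[kx xk]; rewrite fpsi ?(le_trans _ kx)//.
    apply: le_trans (@drift_lipschitz R N K A (B * del) omega _ _ _ i K0 _ _) _ => //.
      move=> j; apply: le_trans (psiL _ _ _ (grid0 k) kx) _.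
      by rewrite ler_wpM2l// lerBlDr -grid1.
  - move=> {}k {}i kn; apply: le_trans (psiL _ _ _ (grid0 k) (gridW k)) _.
    by rewrite gridS.
(* Index of the grid point just below [t]; it equals [n] when [t = T]. *)
pose k := Num.truncn (t / del).
have /andP[kt tk] : k%:R <= t / del < k.+1%:R.
  by apply: truncn_itv; rewrite divr_ge0// ltW.
have {}kt : k%:R * del <= t by rewrite -ler_pdivlMr.
have {}tk : t <= k%:R * del + del.
  by rewrite -{2}[del]mul1r -mulrDl natr1 -ler_pdivrMr// ltW.
have kn : (k <= n)%N.
  by rewrite -(ler_nat R) -(ler_pM2r del0) ndel (le_trans kt).
have JE : (0 : R) <= \sum_(l < n) (jump l)%:R by rewrite sumr_ge0.
apply: torus_dist_lift_le (fun i => lphi t i t0) (fun i => lpsi t i t0) _ _.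
  have p1 : 0 <= K * (S * (1 + 2 * (B * T))).
    by rewrite !mulr_ge0// addr_ge0// !mulr_ge0// ltW.
  have p2 : 0 <= 2 * T * del + del * \sum_(l < n) (jump l)%:R.
    by rewrite addr_ge0// !mulr_ge0// ltW.
  have p3 : 0 <= 2 * (B * del) by rewrite !mulr_ge0// ltW.
  exact: addr_ge0 (mulr_ge0 (addr_ge0 p1 (mulr_ge0 C0 p2)) (expR_ge0 _)) p3.
move=> i.
have -> : phi t i - psi t i = (phi (k%:R * del) i - psi (k%:R * del) i) +
  ((phi t i - phi (k%:R * del) i) - (psi t i - psi (k%:R * del) i)) by ring.
apply: le_trans (ler_normD _ _) _; apply: lerD.
  apply: le_trans (main k i kn) _.
  have -> : K * (A * 2) * del * n%:R = K * (A * 2) * T by rewrite -ndel; ring.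
  rewrite -/C ndel le_eqVlt; apply/orP; left; apply/eqP.
  rewrite -ndel; ring.
apply: le_trans (ler_normB _ _) _; rewrite mulr2n mulrDl mul1r.
by apply: lerD; [apply: le_trans (phiL _ _ _ (grid0 k) kt) _ |
  apply: le_trans (psiL _ _ _ (grid0 k) kt) _];
  rewrite ler_wpM2l// lerBlDr addrC.
Qed.

(** * Mixing of the embedded chain *)

Definition transition (R : realType) (V : finType) (p : V -> V -> R)
    (f : V -> R) (u : V) : R := \sum_v p u v * f v.

Definition n_step (R : realType) (V : finType) (p : V -> V -> R) (n : nat)
    (u v : V) : R := iter n (transition p) (fun x => (x == v)%:R) u.

Definition stochastic (R : realType) (V : finType) (p : V -> V -> R) : Prop :=
  (forall u v, 0 <= p u v) /\ forall u, \sum_v p u v = 1.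

Lemma le_iter_transition (R : realType) (V : finType) (p : V -> V -> R)
    (n : nat) (f g : V -> R) :
  stochastic p -> (forall u, f u <= g u) ->
  forall u, iter n (transition p) f u <= iter n (transition p) g u.
Proof.
move=> [p0 _] fg; elim: n => //= n IH u.
by apply: ler_sum => v _; rewrite ler_wpM2l.
Qed.

Lemma iter_transition_affine (R : realType) (V : finType) (p : V -> V -> R)
    (n : nat) (c d : R) (g : V -> R) (u : V) :
  stochastic p ->
  iter n (transition p) (fun x => c + d * g x) u =
  c + d * iter n (transition p) g u.
Proof.
move=> [_ p1]; elim: n u => //= n IH u.
rewrite /transition -[c in RHS]mulr1 -(p1 u) !mulr_sumr -big_split/=.
by apply: eq_bigr => v _; rewrite IH; ring.
Qed.

Lemma iter_transition_bounds (R : realType) (V : finType) (p : V -> V -> R)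
    (n : nat) (f : V -> R) (lo hi : R) :
  stochastic p -> (forall u, lo <= f u <= hi) ->
  forall u, lo <= iter n (transition p) f u <= hi.
Proof.
move=> sp fb u.
have cst c : iter n (transition p) (fun=> c) u = c.
  transitivity (c + 0 * iter n (transition p) (fun=> 0) u); last by rewrite mul0r addr0.
  rewrite -iter_transition_affine//; congr (iter _ _ _ _).
  by apply/funext => x; rewrite mul0r addr0.
by rewrite -{1}(cst lo) -(cst hi) !le_iter_transition// => x; case/andP: (fb x).
Qed.

Lemma n_stepS_gt0 (R : realType) (V : finType) (p : V -> V -> R) (n : nat)
    (u x v : V) :
  stochastic p -> 0 < p u x -> 0 < n_step p n x v -> 0 < n_step p n.+1 u v.
Proof.
move=> sp pux nxv; rewrite /n_step iterS {1}/transition (bigD1 x)//=.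
rewrite ltr_pwDl ?mulr_gt0// sumr_ge0// => y _; rewrite mulr_ge0 ?sp.1//.
have d01 z : 0 <= ((z == v)%:R : R) <= 1 by case: eqP => _; rewrite ?lexx ler01.
by have /andP[] := iter_transition_bounds n sp d01 y.
Qed.

(** A path can be lengthened by waiting at a self-loop, so the largest of finitely many path lengths
    serves all pairs. *)
Lemma n_step_primitive (R : realType) (V : finType) (p : V -> V -> R) :
  stochastic p -> (forall u, 0 < p u u) ->
  (forall u v, connect (fun a b => 0 < p a b) u v) ->
  exists n, forall u v, 0 < n_step p n u v.
Proof.
move=> sp loop conn.
have stay n m u v : 0 < n_step p n u v -> 0 < n_step p (m + n) u v.
  by move=> nuv; elim: m => // m IH; rewrite addSn; apply: n_stepS_gt0 IH.
have [f fP] : exists f : V * V -> nat, forall x, 0 < n_step p (f x) x.1 x.2.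
  apply: (@fin_all_exists _ (fun=> nat) (fun x m => 0 < n_step p m x.1 x.2))
    => -[u v] /=; have /connectP[s us ->] := conn u v.
  exists (size s); elim: s u us => [u _|y s IH u /= /andP[uy ys]].
    by rewrite /n_step/= eqxx ltr01.
  by apply: n_stepS_gt0 (uy) _ => //; apply: IH.
exists (\max_x f x) => u v.
rewrite -(subnK (leq_bigmax (F := f) (u, v))); apply: stay; exact: (fP (u, v)).
Qed.

Lemma positive_lower_bound (R : realType) (I : finType) (f : I -> R) :
  (forall i, 0 < f i) -> exists2 a, 0 < a < 1 & forall i, a <= f i.
Proof.
move=> f0; exists (\big[Num.min/2^-1]_i f i).
  apply/andP; split.
    by elim/big_ind : _ => // x y x0 y0; rewrite lt_min x0.
  apply: (@le_lt_trans _ _ 2^-1); last by rewrite invf_lt1// ltr1n.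
  elim/big_rec : _ => // i x _ x2; by rewrite ge_min x2 orbT.
by move=> i; rewrite (bigD1 i)//= ge_min lexx.
Qed.

(** From any start, [n] steps put mass at least [al] on a minimizer [m] of [f]. This lowers the
    maximum enough to shrink the oscillation bound by [1 - al], while the minimum cannot
    decrease. *)
Lemma doeblin_contraction (R : realType) (V : finType) (p : V -> V -> R)
    (n : nat) (al : R) :
  stochastic p -> al < 1 -> (forall u v, al <= n_step p n u v) ->
  forall k (f : V -> R) lo C, 0 <= C -> (forall u, lo <= f u <= lo + C) ->
  exists lo', forall u,
    lo' <= iter (k * n) (transition p) f u <= lo' + (1 - al) ^+ k * C.
Proof.
move=> sp al1 aln; elim=> [f lo C C0 fb|k IH f lo C C0 fb].
  by exists lo => u; rewrite mul0n/= expr0 mul1r.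
have [V0|/card_gt0P[x0 _]] := posnP #|V|.
  by exists 0 => u; have := fintype0 u V0.
have [m mP] : exists m, forall u, f m <= f u.
  by exists [arg min_(u < x0) f u]%O; case: arg_minP => // m _ + u; apply.
have fm u : f u <= (lo + C) + - (lo + C - f m) * (u == m)%:R.
  have /andP[_ fu] := fb u.
  by case: eqP => [->|_]; rewrite ?mulr1 ?mulr0 ?addr0// opprB addrC subrK.
have fb' u : f m <= iter n (transition p) f u <= f m + (1 - al) * C.
  have /andP[lm mC] := fb m.
  have fmb v : f m <= f v <= lo + C by rewrite mP; case/andP: (fb v).
  have /andP[-> _] /= := iter_transition_bounds n sp fmb u.
  apply: le_trans (le_iter_transition n sp fm u) _.
  rewrite iter_transition_affine// -/(n_step p n u m).
  have := ler_wpM2l (_ : 0 <= lo + C - f m) (aln u m); rewrite subr_ge0 => /(_ mC).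
  have : 0 <= (1 - al) * (f m - lo) by rewrite mulr_ge0// subr_ge0// ltW.
  set q := n_step _ _ _ _; move: mC; lra.
have C'0 : 0 <= (1 - al) * C by rewrite mulr_ge0// subr_ge0 ltW.
have [lo' H] := IH _ _ _ C'0 fb'.
by exists lo' => u; rewrite mulSn addnC iterD exprSr -mulrA.
Qed.

Lemma vertex_weight_gt0 (R : realType) (V : finType) (w : V -> V -> R) (u : V) :
  skeleton w -> 0 < vertex_weight w u.
Proof.
move=> [w0 _ wl _]; rewrite /vertex_weight (bigD1 u)//= ltr_pwDl//.
exact: sumr_ge0.
Qed.

Lemma jump_prob_stochastic (R : realType) (V : finType) (w : V -> V -> R) :
  skeleton w -> stochastic (jump_prob w).
Proof.
move=> sw; split=> [u v|u].
  by rewrite divr_ge0// ?(skeleton_ge0 sw)// ltW// vertex_weight_gt0.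
by rewrite -mulr_suml divff// lt0r_neq0// vertex_weight_gt0.
Qed.

Lemma total_weight_gt0 (R : realType) (V : finType) (w : V -> V -> R) (u : V) :
  skeleton w -> 0 < \sum_v vertex_weight w v.
Proof.
move=> sw; rewrite (bigD1 u)//= ltr_pwDl ?vertex_weight_gt0// sumr_ge0// => v _.
by rewrite ltW// vertex_weight_gt0.
Qed.

Lemma reversible_measure_ge0 (R : realType) (V : finType) (w : V -> V -> R)
    (u : V) : skeleton w -> 0 <= reversible_measure w u.
Proof.
move=> sw; rewrite divr_ge0//; first by rewrite ltW// vertex_weight_gt0.
by rewrite ltW// total_weight_gt0.
Qed.

Lemma sum_reversible_measure (R : realType) (V : finType) (w : V -> V -> R)
    (u : V) : skeleton w -> \sum_v reversible_measure w v = 1.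
Proof.
by move=> sw; rewrite -mulr_suml divff// lt0r_neq0// total_weight_gt0.
Qed.

(** Detailed balance: mu(u) p(u, v) = mu(v) p(v, u), by symmetry of [w]. *)
Lemma reversible_measure_invariant (R : realType) (V : finType)
    (w : V -> V -> R) (n : nat) (f : V -> R) : skeleton w ->
  \sum_u reversible_measure w u * iter n (transition (jump_prob w)) f u =
  \sum_u reversible_measure w u * f u.
Proof.
move=> sw; elim: n => // n IH; rewrite -{}IH.
under eq_bigr do rewrite iterS {1}/transition mulr_sumr.
rewrite exchange_big/=; apply: eq_bigr => v _.
rewrite -[in RHS](mulr1 (reversible_measure w v)) -((jump_prob_stochastic sw).2 v).
rewrite mulr_sumr mulr_suml; apply: eq_bigr => u _.
have := lt0r_neq0 (vertex_weight_gt0 u sw); have := lt0r_neq0 (vertex_weight_gt0 v sw).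
have := lt0r_neq0 (total_weight_gt0 v sw).
rewrite /reversible_measure /jump_prob (skeleton_sym sw u v) => a b c; field.
by rewrite a b.
Qed.

(** Contraction confines [n_step m x v] to a short window for all [x]. By invariance mu(v) is a mean
    of these values, hence lies in the same window. *)
Lemma n_step_mixing (R : realType) (V : finType) (w : V -> V -> R) (eta : R) :
  skeleton w -> 0 < eta -> exists n0, forall n u v, (n0 <= n)%N ->
    `|n_step (jump_prob w) n u v - reversible_measure w v| <= eta.
Proof.
move=> sw eta0; have sp := jump_prob_stochastic sw.
have [u||n nP] := n_step_primitive sp.
- by rewrite divr_gt0 ?(skeleton_loop sw)// vertex_weight_gt0.
- move=> u v; have := skeleton_connected sw u v.
  rewrite (@eq_connect _ _ (fun a b => 0 < jump_prob w a b))// => a b.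
  by rewrite /jump_prob pmulr_lgt0// invr_gt0 vertex_weight_gt0.
have [al /andP[al0 al1] alP] := @positive_lower_bound R (V * V)%type
  (fun x => n_step (jump_prob w) n x.1 x.2) (fun x => nP x.1 x.2).
have [k kP] : exists k, (1 - al) ^+ k <= eta.
  have := @cvg_expr R (1 - al).
  rewrite ger0_norm ?subr_ge0 ?(ltW al1)// ltrBlDr ltrDl => /(_ al0).
  move=> /cvgrPdist_le/(_ _ eta0)[k _ H]; exists k; have := H k (leqnn k).
  by rewrite /= sub0r normrN ger0_norm// exprn_ge0// subr_ge0 ltW.
exists (k * n)%N => m u v knm.
have d01 x : 0 <= ((x == v)%:R : R) <= 0 + 1.
  by case: eqP => _; rewrite add0r ?lexx ler01.
have [lo H] := doeblin_contraction sp al1 (fun a b => alP (a, b)) k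
  ler01 d01.
rewrite mulr1 in H.
have {}H x : lo <= n_step (jump_prob w) m x v <= lo + (1 - al) ^+ k.
  rewrite /n_step -(subnK knm) iterD; exact: iter_transition_bounds.
have muE : \sum_x reversible_measure w x * n_step (jump_prob w) m x v =
    reversible_measure w v.
  rewrite reversible_measure_invariant// (bigD1 v)//= eqxx mulr1 big1 ?addr0//.
  by move=> x /negPf->; rewrite mulr0.
have cst c : c = \sum_x reversible_measure w x * c.
  by rewrite -mulr_suml (sum_reversible_measure u sw) mul1r.
have mulo : lo <= reversible_measure w v.
  rewrite -muE {1}(cst lo); apply: ler_sum => x _; have /andP[h _] := H x.
  by rewrite ler_wpM2l// reversible_measure_ge0.
have muhi : reversible_measure w v <= lo + (1 - al) ^+ k.
  rewrite -muE (cst (lo + _)); apply: ler_sum => x _; have /andP[_ h] := H x.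
  by rewrite ler_wpM2l// reversible_measure_ge0.
rewrite ler_norml; have /andP[] := H u; lra.
Qed.

(** * Two-time law of a random walk *)

(** Real-valued, hence within reach of [ring] and [lra]; faithful on measurable sets by [prE]. *)
Definition pr d (O : measurableType d) (R : realType) (P : probability O R)
  (A : set O) : R := fine (P A).

Lemma pr_ge0 d (O : measurableType d) (R : realType) (P : probability O R)
  (A : set O) : 0 <= pr P A.
Proof. by rewrite fine_ge0. Qed.

Lemma prE d (O : measurableType d) (R : realType) (P : probability O R)
  (A : set O) : measurable A -> P A = (pr P A)%:E.
Proof. by move=> mA; rewrite fineK// fin_num_measure. Qed.

Lemma le_pr d (O : measurableType d) (R : realType) (P : probability O R)
    (A B : set O) :
  measurable A -> measurable B -> A `<=` B -> pr P A <= pr P B.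
Proof.
by move=> mA mB AB; rewrite -lee_fin -!prE//; apply: le_measure; rewrite ?inE.
Qed.

Lemma pr_le1 d (O : measurableType d) (R : realType) (P : probability O R)
  (A : set O) : measurable A -> pr P A <= 1.
Proof. by move=> mA; rewrite -lee_fin -prE// probability_le1. Qed.

Lemma pr_setT d (O : measurableType d) (R : realType) (P : probability O R) :
  pr P setT = 1.
Proof. by rewrite /pr probability_setT. Qed.

Lemma pr_set0 d (O : measurableType d) (R : realType) (P : probability O R) :
  pr P set0 = 0.
Proof. by rewrite /pr measure0. Qed.

Lemma pr_partition d (O : measurableType d) (R : realType) (P : probability O R)
    (I : finType) (g : O -> I) (A : set O) :
  (forall i, measurable (g @^-1` [set i])) -> measurable A ->
  pr P A = \sum_i pr P (A `&` g @^-1` [set i]).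
Proof.
move=> mg mA; apply: EFin_inj; rewrite -prE// -sumEFin.
have mAg i : measurable (A `&` g @^-1` [set i]) by exact: measurableI.
under eq_bigr do rewrite -prE//.
have AE : \bigcup_(i in [set` enum I]) (A `&` g @^-1` [set i]) = A.
  apply/seteqP; split=> [ o [i _ []]//|o Ao]; exists (g o) => //=.
  by rewrite mem_enum.
rewrite -{1}AE measure_fin_bigcup//; first by rewrite -fsbig_seq ?enum_uniq// big_enum.
by move=> i j _ _ [ o [[_ /= <-] [_ /= <-]]].
Qed.

Lemma independent_pair d (O : measurableType d) (R : realType)
    (P : probability O R) (I : finType) (F : I -> set (set O)) (i j : I)
    (A B : set O) :
  independent_families P F -> i != j -> F i A -> F j B ->
  measurable A -> measurable B -> pr P (A `&` B) = pr P A * pr P B.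
Proof.
move=> indF ij FA FB mA mB.
have := indF [set i; j]%SET (fun k => if k == i then A else B).
have jni : (j == i) = false by rewrite eq_sym (negPf ij).
have -> : \bigcap_(k in [set` [set i; j]%SET]) (if k == i then A else B) = A `&` B.
  apply/seteqP; split=> [ o H|o [Ao Bo] k _]; last by case: ifP.
  have := H i; have := H j; rewrite /= !inE !eqxx jni orbT => Bo Ao.
  by split; [apply: Ao | apply: Bo].
rewrite big_setU1 ?inE//= big_set1 eqxx jni => H.
rewrite /pr H ?fineM ?fin_num_measure// => k; rewrite !inE.
by case: eqP => [->|_]//= /eqP ->.
Qed.

Lemma process_sigmaI (O I S : Type) (D : set I) (X : I -> O -> S) (s t : I)
    (A B : set S) : D s -> D t ->
  process_sigma D X (X s @^-1` A `&` X t @^-1` B).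
Proof.
move=> Ds Dt; have := smallest_sigma_algebra setT
  [set X t @^-1` B | t in D & B in [set: set S]].
move=> /sigma_algebraP[//|_ _ _]; apply.
  by apply: sub_sigma_algebra; exists s => //; exists A.
by apply: sub_sigma_algebra; exists t => //; exists B.
Qed.

Definition path_event (O V : Type) (Y : nat -> O -> V) (m : nat) (c : nat -> V)
  : set O := \bigcap_(k in `I_m.+1) (Y k @^-1` [set c k]).

(** [markov_chain_step] speaks of whole paths from time 0, so the induction on [n] carries a whole
    path and lengthens it by splitting over [Y m.+1]. *)
Lemma markov_path_n_step d (O : measurableType d) (R : realType)
    (P : probability O R) (V : finType) (p : V -> V -> R) (v0 : V)
    (Y : nat -> O -> V) (n m : nat) (c : nat -> V) (v : V) :
  markov_chain P p v0 Y ->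
  pr P (path_event Y m c `&` Y (m + n)%N @^-1` [set v]) =
  pr P (path_event Y m c) * n_step p n (c m) v.
Proof.
move=> mc; have mY k B := markov_chain_meas mc k B.
have mpath k c' : measurable (path_event Y k c').
  by apply: bigcap_measurable => [|i _]; [exists 0%N | exact: mY].
elim: n m c => [|n IH] m c.
  rewrite addn0 /n_step/=; case: eqP => [cm|cm].
    rewrite mulr1; congr pr; apply/seteqP; split=> [ o []//|o Ho]; split=> //.
    by rewrite /preimage/= -cm; apply: Ho => /=.
  rewrite mulr0 -(pr_set0 P); congr pr; apply/seteqP; split=> // o [Ho /= Yv].
  by apply: cm; rewrite -Yv; apply/esym; apply: Ho => /=.
rewrite (pr_partition P (g := Y m.+1)) => [|x|]; [|exact: mY|exact: measurableI].
rewrite /n_step iterS -/(n_step p n) /transition mulr_sumr; apply: eq_bigr => x _.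
pose c' k := if k == m.+1 then x else c k.
have c'm : c' m = c m by rewrite /c' ltn_eqF.
have pathS : path_event Y m.+1 c' = path_event Y m c `&` Y m.+1 @^-1` [set x].
  apply/seteqP; split=> [ o H|o [H Hx] k /= km]; first split.
  - move=> k /= km; have := H k; rewrite /preimage/= /c' ltn_eqF//; apply.
    exact: ltnW.
  - by have := H m.+1; rewrite /preimage/= /c' eqxx; apply.
  - move: km; rewrite ltnS leq_eqVlt /c'; case: eqP => [-> _|_ /= km]//.
    exact: H.
have pathc' : path_event Y m c' = path_event Y m c.
  by apply/seteqP; split=> o H k /= km; have := H k km;
    rewrite /preimage/= /c' ltn_eqF.
rewrite setIAC -pathS addnS -addSn IH /c' eqxx mulrA; congr (_ * _).
have := markov_chain_step mc m c'.
rewrite -/(path_event Y m.+1 c') -/(path_event Y m c') pathc' c'm.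
by rewrite !prE// -EFinM => -[->]; rewrite /c' eqxx.
Qed.

Lemma markov_two_time d (O : measurableType d) (R : realType)
    (P : probability O R) (V : finType) (p : V -> V -> R) (v0 : V)
    (Y : nat -> O -> V) (m n : nat) (u v : V) :
  markov_chain P p v0 Y ->
  pr P (Y m @^-1` [set u] `&` Y (m + n)%N @^-1` [set v]) =
  pr P (Y m @^-1` [set u]) * n_step p n u v.
Proof.
move=> mc; have mY k B := markov_chain_meas mc k B.
(* The past as an element of a finite type: conditioning on it is a finite partition. *)
pose g o := [ffun k : 'I_m.+1 => Y k o].
pose c (f : {ffun 'I_m.+1 -> V}) k := f (inord k).
have gE f : g @^-1` [set f] = path_event Y m (c f).
  apply/seteqP; split=> [ o /= <- k /= km|o H]; rewrite /preimage/=.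
    by rewrite /c ffunE inordK.
  apply/ffunP => k; rewrite ffunE; have := H k (ltn_ord k).
  by rewrite /preimage/= /c inord_val.
have mg f : measurable (g @^-1` [set f]).
  by rewrite gE; apply: bigcap_measurable => [|i _]; [exists 0%N | exact: mY].
rewrite (pr_partition P mg (mY _ _)) mulr_suml (pr_partition P mg); last first.
  exact: measurableI.
apply: eq_bigr => f _; rewrite gE setIAC.
have [fu|fu] := eqVneq (c f m) u.
  have -> : Y m @^-1` [set u] `&` path_event Y m (c f) = path_event Y m (c f).
    apply/seteqP; split=> [ o []//|o H]; split=> //.
    by rewrite -fu; apply: H => /=.
  by rewrite (markov_path_n_step _ _ _ _ mc) fu.
have -> : Y m @^-1` [set u] `&` path_event Y m (c f) = set0.
  apply/seteqP; split=> // o [/= Yu H]; move/eqP: fu; apply.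
  by rewrite -Yu; apply/esym; apply: H => /=.
by rewrite set0I pr_set0 mul0r.
Qed.

(** * Number of jumps in a time interval *)

Lemma pr_setC d (O : measurableType d) (R : realType) (P : probability O R)
  (A : set O) : measurable A -> pr P (~` A) = 1 - pr P A.
Proof.
move=> mA; apply: EFin_inj; rewrite -prE ?probability_setC//; last exact: measurableC.
by rewrite prE.
Qed.

Lemma pr_setU_le d (O : measurableType d) (R : realType) (P : probability O R)
    (A B : set O) :
  measurable A -> measurable B -> pr P (A `|` B) <= pr P A + pr P B.
Proof.
move=> mA mB; rewrite -lee_fin EFinD -!prE//; last exact: measurableU.
exact: measureU2.
Qed.

(** The weight of [k] is [k.+1 / lam] times the weight of [k.+1], which is at most 1. *)
Lemma poisson_pmf_le (R : realType) (lam : R) (k : nat) :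
  0 < lam -> poisson_pmf lam k <= k.+1%:R / lam.
Proof.
move=> lam0; rewrite /poisson_pmf lam0 expRN.
have H : lam ^+ k.+1 / k.+1`!%:R <= expR lam.
  by apply: le_trans (expR_ge1Dxn k (ltW lam0)); rewrite lerDr.
have -> : lam ^+ k / k`!%:R / expR lam =
    k.+1%:R / lam * (lam ^+ k.+1 / k.+1`!%:R / expR lam).
  rewrite factS natrM exprS; field.
  by rewrite !pnatr_eq0 -lt0n fact_gt0 /= !lt0r_neq0 ?expR_gt0.
by rewrite ler_piMr ?divr_ge0 ?(ltW lam0)// ler_pdivrMr ?expR_gt0// mul1r.
Qed.

Lemma poisson_increment_measurable d (O : measurableType d) (R : realType)
    (P : probability O R) (rate : R) (M : R -> O -> nat) (s t : R)
    (D : nat -> nat -> Prop) :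
  poisson_process P rate M -> 0 <= s -> 0 <= t ->
  measurable [set o | D (M s o) (M t o)].
Proof.
move=> pp s0 t0.
have -> : [set o | D (M s o) (M t o)] =
   \bigcup_k (M s @^-1` [set k] `&` M t @^-1` [set l | D k l]).
  by apply/seteqP; split=> [ o H|o [k _ [/= <-]]//]; exists (M s o).
by apply: bigcup_measurable => k _; apply: measurableI;
  exact: poisson_process_meas pp _ _ _.
Qed.

(** A union bound over the [n] values of the increment, each of probability at most [n] over the
    mean. Crude, but it vanishes as the mean grows with [n] fixed. *)
Lemma poisson_small_increment d (O : measurableType d) (R : realType)
    (P : probability O R) (rate : R) (M : R -> O -> nat) (s t : R) (n : nat) :
  poisson_process P rate M -> 0 < rate -> 0 <= s -> s < t ->
  pr P [set o | (M t o < M s o + n)%N] <= (n ^ 2)%:R / (rate * (t - s)).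
Proof.
move=> pp rate0 s0 st; have t0 : 0 <= t by rewrite (le_trans s0)// ltW.
have lam0 : 0 < rate * (t - s) by rewrite mulr_gt0// subr_gt0.
have mD D := poisson_increment_measurable D pp s0 t0.
pose E k := [set o | (M t o - M s o)%N = k].
have incl : [set o | (M t o < M s o + n)%N] `<=` \big[setU/set0]_(k < n) E k.
  move=> o /= H; rewrite -(bigcup_mkord n E); exists (M t o - M s o)%N => //=.
  by rewrite ltn_subLR// (poisson_process_mono pp)// ltW.
apply: (@le_trans _ _ (\sum_(k < n) pr P (E k))).
  apply: (@le_trans _ _ (pr P (\big[setU/set0]_(k < n) E k))).
    apply: le_pr => //; first exact: (mD (fun a b => (b < a + n)%N)).
    by apply: bigsetU_measurable => k _; exact: (mD (fun a b => (b - a)%N = k)).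
  elim: n {incl} => [|n IH]; first by rewrite !big_ord0 pr_set0.
  rewrite !big_ord_recr/=; apply: le_trans (pr_setU_le _ _ _) _.
  - by apply: bigsetU_measurable => k _; exact: (mD (fun a b => (b - a)%N = k)).
  - exact: (mD (fun a b => (b - a)%N = n)).
  - by rewrite lerD2r.
apply: (@le_trans _ _ (\sum_(k < n) n%:R / (rate * (t - s)))).
  apply: ler_sum => k _; rewrite /pr (poisson_process_law pp)//=.
  apply: le_trans (poisson_pmf_le _ lam0) _.
  by rewrite ler_pM2r ?invr_gt0// ler_nat.
by rewrite sumr_const card_ord -[leLHS]mulr_natl mulrA -natrM mulnn.
Qed.

Lemma poisson_jump_le d (O : measurableType d) (R : realType)
    (P : probability O R) (rate : R) (M : R -> O -> nat) (s t : R) :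
  poisson_process P rate M -> 0 < rate -> 0 <= s -> s < t ->
  pr P [set o | M s o != M t o] <= rate * (t - s).
Proof.
move=> pp rate0 s0 st; have t0 : 0 <= t by rewrite (le_trans s0)// ltW.
have lam0 : 0 < rate * (t - s) by rewrite mulr_gt0// subr_gt0.
have -> : [set o | M s o != M t o] = ~` [set o | (M t o - M s o)%N = 0%N].
  apply/seteqP; split=> o /=.
    move=> ne /eqP; rewrite subn_eq0 => ts; move: ne.
    by rewrite eqn_leq ts (poisson_process_mono pp)// ltW.
  by move=> h; apply/eqP => st'; apply: h; rewrite st' subnn.
rewrite pr_setC; last first.
  exact: (poisson_increment_measurable (fun a b => (b - a)%N = 0%N) pp).
rewrite /pr (poisson_process_law pp)//= /poisson_pmf lam0 expr0 mul1r fact0.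
by rewrite invr1 mul1r; have := expR_ge1Dx (- (rate * (t - s))); lra.
Qed.

(** Continuity from above; it lets the jump counter be cut down to finitely many values. *)
Lemma nat_rv_tight d (O : measurableType d) (R : realType)
    (P : probability O R) (M : O -> nat) (eta : R) :
  (forall B, measurable (M @^-1` B)) -> 0 < eta ->
  exists L, pr P [set o | (L < M o)%N] <= eta.
Proof.
move=> mM eta0.
pose F L := M @^-1` [set k | (L < k)%N].
have capF : \bigcap_L F L = set0.
  by apply/seteqP; split=> // o /(_ (M o) I); rewrite /F/= ltnn.
have : P \o F @ \oo --> P (\bigcap_L F L).
  apply: nonincreasing_cvg_mu.
  - exact: le_lt_trans (probability_le1 _ (mM _)) (ltry _).
  - by move=> k; exact: mM.
  - by rewrite capF.
  - by move=> m n mn; apply/subsetPset => o /=; apply: leq_ltn_trans.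
rewrite capF measure0 => /fine_cvg/cvgrPdist_le/(_ _ eta0)[L _ H].
exists L; have := H L (leqnn L); rewrite /= sub0r normrN ger0_norm// fine_ge0//.
Qed.

Lemma random_walk_measurable d (O : measurableType d) (R : realType)
    (P : probability O R) (V : finType) (p : V -> V -> R) (rate : R) (v0 : V)
    (X : R -> O -> V) (t : R) (B : set V) :
  random_walk P p rate v0 X -> 0 <= t -> measurable (X t @^-1` B).
Proof.
move=> [Y [M [mc pp _ XE]]] t0.
have -> : X t @^-1` B = \bigcup_k (M t @^-1` [set k] `&` Y k @^-1` B).
  apply/seteqP; split=> [ o H|o [k _ []]]; last by rewrite /preimage/= XE// => ->.
  by exists (M t o) => //; split; rewrite // /preimage/= -XE.
by apply: bigcup_measurable => k _; apply: measurableI;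
  [exact: poisson_process_meas pp _ _ _ | exact: markov_chain_meas mc _ _].
Qed.

(* Conditionally on the number of jumps at times s and r, independent of the
   embedded chain, the two positions are those of the chain n steps apart, and
   n is large with high probability. *)
Lemma random_walk_mixing (R : realType) (V : finType) (w : V -> V -> R)
    (eta : R) :
  skeleton w -> 0 < eta -> exists2 Lam, 0 < Lam &
  forall d (O : measurableType d) (P : probability O R) (rate : R) (v0 : V)
    (X : R -> O -> V) (s r : R) (u v : V),
  random_walk P (jump_prob w) rate v0 X -> 0 < rate -> 0 <= s -> s < r ->
  Lam <= rate * (r - s) ->
  `|pr P (X s @^-1` [set u] `&` X r @^-1` [set v]) -
    pr P (X s @^-1` [set u]) * reversible_measure w v| <= eta.
Proof.
move=> sw eta0; have eta3 : 0 < eta / 3 by rewrite divr_gt0.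
have [n0 n0P] := n_step_mixing sw eta3.
(* Makes fewer than [n0] jumps an event of probability at most [eta / 3]; the [+ 1] keeps the
   threshold positive when [n0 = 0]. *)
exists ((n0 ^ 2)%:R / (eta / 3) + 1).
  by rewrite ltr_wpDl// divr_ge0// ltW.
move=> d O P rate v0 X s r u v rw rate0 s0 sr Lamle.
have r0 : 0 <= r by rewrite (le_trans s0)// ltW.
have mX t B : 0 <= t -> measurable (X t @^-1` B).
  exact: random_walk_measurable rw.
have [Y [M [mc pp ind XE]]] := rw.
have mY k B := markov_chain_meas mc k B.
have mD D := poisson_increment_measurable D pp s0 r0.
have mMr B : measurable (M r @^-1` B) by exact: poisson_process_meas pp _ _ _.
(* [L] may depend on the space and on [r]: it makes the partition finite and enters no bound. *)
have [L HL] := nat_rv_tight P mMr eta3.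
pose Bad := [set o | (M r o < M s o + n0)%N \/ (L < M r o)%N].
have mBad : measurable Bad by exact: (mD (fun a b => (b < a + n0)%N \/ (L < b)%N)).
have prBad : pr P Bad <= 2 * (eta / 3).
  apply: (@le_trans _ _ (pr P [set o | (M r o < M s o + n0)%N] +
    pr P [set o | (L < M r o)%N])).
    apply: (@pr_setU_le _ _ _ P) => //.
      exact: (mD (fun a b => (b < a + n0)%N)).
    exact: (mD (fun a b => (L < b)%N)).
  rewrite mulr2n mulrDl mul1r lerD//.
  apply: le_trans (poisson_small_increment n0 pp rate0 s0 sr) _.
  have lam0 : 0 < rate * (r - s) by rewrite mulr_gt0// subr_gt0.
  rewrite ler_pdivrMr// mulrC -ler_pdivrMr//.
  by rewrite (le_trans _ Lamle)// lerDl.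
(* [L.+1] is the overflow value. An overflowing cell is inside [Bad]: either [L < M r o], or
   [M r o <= L < M s o] and then [M r o < M s o + n0]. *)
pose h (a b : nat) : 'I_L.+2 * 'I_L.+2 :=
  (inord (minn a L.+1), inord (minn b L.+1)).
pose g o := h (M s o) (M r o).
have mg c : measurable (g @^-1` [set c]) by exact: (mD (fun a b => h a b = c)).
set U := X s @^-1` [set u]; set W := X r @^-1` [set v].
have mU : measurable U by exact: mX.
have mW : measurable W by exact: mX.
set mu := reversible_measure w v.
have mu0 : 0 <= mu by exact: reversible_measure_ge0.
have mu1 : mu <= 1.
  rewrite -(sum_reversible_measure u sw) (bigD1 v)//= lerDl sumr_ge0// => x _.
  exact: reversible_measure_ge0.
(* In a cell inside [Bad] both terms are at most its probability; a cell with a good point fixes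
   both jump counts, and the chain estimate applies. Summation gives [2 * (eta / 3) + eta / 3]. *)
have key c : `|pr P (U `&` W `&` g @^-1` [set c]) -
    pr P (U `&` g @^-1` [set c]) * mu| <=
    pr P (Bad `&` g @^-1` [set c]) + eta / 3 * pr P (g @^-1` [set c]).
  have [cBad|] := pselect (g @^-1` [set c] `<=` Bad).
    have -> : Bad `&` g @^-1` [set c] = g @^-1` [set c] by apply/setIidPr.
    have a0 := pr_ge0 P (U `&` W `&` g @^-1` [set c]).
    have b0 := pr_ge0 P (U `&` g @^-1` [set c]).
    have a1 : pr P (U `&` W `&` g @^-1` [set c]) <= pr P (g @^-1` [set c]).
      by apply: le_pr; [do 2!apply: measurableI => // | | move=> o []].
    have b1 : pr P (U `&` g @^-1` [set c]) <= pr P (g @^-1` [set c]).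
      by apply: le_pr; [exact: measurableI | | move=> o []].
    have c0 := ler_pM b0 mu0 b1 mu1; have d0 := mulr_ge0 b0 mu0.
    have e0 : 0 <= eta / 3 * pr P (g @^-1` [set c]) by rewrite mulr_ge0 ?pr_ge0// ltW.
    by rewrite ler_norml; move: c0; rewrite mulr1 => c0; apply/andP; split; lra.
  move=> /existsNP[ o0 /not_implyP[/= go0 nBad]].
  have [/negP H1 /negP H2] : ~ (M r o0 < M s o0 + n0)%N /\ ~ (L < M r o0)%N by apply/not_orP.
  rewrite -!leqNgt in H1 H2.
  set m := M s o0 in H1; set l := M r o0 in H1 H2.
  have mL : (m <= L)%N by apply: leq_trans H2; apply: leq_trans H1; exact: leq_addr.
  have gE : g @^-1` [set c] = M s @^-1` [set m] `&` M r @^-1` [set l].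
    have minE a b : (b <= L)%N -> (inord (minn a L.+1) : 'I_L.+2) = inord (minn b L.+1) -> a = b.
      move=> bL /(congr1 val); rewrite /= !inordK ?ltnS ?geq_minr// (minn_idPl (leqW bL)).
      by rewrite /minn; case: ltnP => // _ E; move: bL; rewrite -E ltnn.
    apply/seteqP; split=> [ o /= E|o [/= E1 E2]]; last by rewrite -go0 /g E1 E2.
    by move: E; rewrite -go0 => -[/minE-> // /minE ->].
  have mMs B : measurable (M s @^-1` B) by exact: poisson_process_meas pp _ _ _.
  have indE A : process_sigma [set: nat] Y A -> measurable A ->
      pr P (A `&` (M s @^-1` [set m] `&` M r @^-1` [set l])) =
      pr P A * pr P (M s @^-1` [set m] `&` M r @^-1` [set l]).
    move=> YA mA; apply: (independent_pair (i := true) (j := false) ind) => //.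
      exact: process_sigmaI.
    exact: measurableI.
  have UWE : U `&` W `&` g @^-1` [set c] = (Y m @^-1` [set u] `&` Y l @^-1` [set v])
      `&` (M s @^-1` [set m] `&` M r @^-1` [set l]).
    rewrite gE /U /W; apply/seteqP; split=> o; rewrite /preimage /=;
      by move=> [[+ +] [E1 E2]]; rewrite !XE// E1 E2.
  have UE : U `&` g @^-1` [set c] = Y m @^-1` [set u]
      `&` (M s @^-1` [set m] `&` M r @^-1` [set l]).
    rewrite gE /U; apply/seteqP; split=> o; rewrite /preimage /=;
      by move=> [+ [E1 E2]]; rewrite !XE// E1.
  rewrite UWE UE indE; [|exact: process_sigmaI|exact: measurableI].
  rewrite indE//; last first.
    by apply: sub_sigma_algebra; exists m => //; exists [set u].
  rewrite -gE; have lE : l = (m + (l - m))%N by rewrite subnKC// (leq_trans _ H1)// leq_addr.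
  rewrite lE (markov_two_time _ _ _ _ mc).
  set q := pr P (Y m @^-1` _); set z := pr P (g @^-1` _).
  have q0 : 0 <= q by exact: pr_ge0.
  have q1 : q <= 1 by exact: pr_le1.
  have z0 : 0 <= z by exact: pr_ge0.
  have lm : (n0 <= l - m)%N by rewrite leq_subRL ?(leq_trans (leq_addr n0 m)).
  have := n0P _ u v lm; set k := n_step _ _ _ _ => kmu.
  have -> : q * k * z - q * z * mu = q * z * (k - mu) by ring.
  rewrite normrM ger0_norm ?mulr_ge0//.
  apply: (@le_trans _ _ (z * (eta / 3))).
    by rewrite ler_pM ?mulr_ge0// ler_piMl.
  by rewrite mulrC lerDr pr_ge0.
rewrite (pr_partition P mg (measurableI _ _ mU mW)) (pr_partition P mg mU).
rewrite mulr_suml -sumrB; apply: le_trans (ler_norm_sum _ _ _) _.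
apply: le_trans (ler_sum _ (fun c _ => key c)) _.
rewrite big_split/= -mulr_sumr -(pr_partition P mg mBad).
have -> : \sum_c pr P (g @^-1` [set c]) = 1.
  rewrite -(pr_setT P) (pr_partition P mg)//.
  by apply: eq_bigr => c _; rewrite setTI.
lra.
Qed.

(** * Expectations of finite combinations *)

Definition integrable_rv d (O : measurableType d) (R : realType)
  (P : probability O R) (Z : O -> R) : Prop := P.-integrable setT (EFin \o Z).

Lemma integrable_rvD d (O : measurableType d) (R : realType)
    (P : probability O R) (Z1 Z2 : O -> R) :
  integrable_rv P Z1 -> integrable_rv P Z2 ->
  integrable_rv P (fun o => Z1 o + Z2 o).
Proof.
move=> i1 i2; rewrite /integrable_rv (_ : _ \o _ = (EFin \o Z1) \+ (EFin \o Z2))//.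
exact: integrableD.
Qed.

Lemma integrable_rvZ d (O : measurableType d) (R : realType)
    (P : probability O R) (c : R) (Z : O -> R) :
  integrable_rv P Z -> integrable_rv P (fun o => c * Z o).
Proof.
move=> iZ; rewrite /integrable_rv.
rewrite (_ : _ \o _ = fun o => (c%:E * (EFin \o Z) o)%E)//.
exact: integrableZl.
Qed.

Lemma integrable_rv_cst d (O : measurableType d) (R : realType)
  (P : probability O R) (c : R) : integrable_rv P (fun=> c).
Proof. exact: finite_measure_integrable_cst. Qed.

Lemma integrable_rv_sum d (O : measurableType d) (R : realType)
    (P : probability O R) (I : Type) (s : seq I) (Z : I -> O -> R) :
  (forall i, integrable_rv P (Z i)) ->
  integrable_rv P (fun o => \sum_(i <- s) Z i o).
Proof.
move=> iZ; elim: s => [|i s IH].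
  by under eq_fun do rewrite big_nil; exact: integrable_rv_cst.
by under eq_fun do rewrite big_cons; exact: integrable_rvD.
Qed.

Lemma Rintegral_rvD d (O : measurableType d) (R : realType)
    (P : probability O R) (Z1 Z2 : O -> R) :
  integrable_rv P Z1 -> integrable_rv P Z2 ->
  \int[P]_o (Z1 o + Z2 o) = \int[P]_o Z1 o + \int[P]_o Z2 o.
Proof. by move=> i1 i2; rewrite RintegralD. Qed.

Lemma Rintegral_rv_cst d (O : measurableType d) (R : realType)
  (P : probability O R) (c : R) : \int[P]_o c = c :> R.
Proof. by rewrite Rintegral_cst// -[fine _]/(pr P setT) pr_setT mulr1. Qed.

Lemma Rintegral_rv_sum d (O : measurableType d) (R : realType)
    (P : probability O R) (I : Type) (s : seq I) (Z : I -> O -> R) :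
  (forall i, integrable_rv P (Z i)) ->
  \int[P]_o (\sum_(i <- s) Z i o) = \sum_(i <- s) \int[P]_o Z i o :> R.
Proof.
move=> iZ; elim: s => [|i s IH].
  by under eq_Rintegral do rewrite big_nil; rewrite Rintegral_rv_cst big_nil.
under eq_Rintegral do rewrite big_cons.
by rewrite Rintegral_rvD ?IH ?big_cons//; exact: integrable_rv_sum.
Qed.

Lemma indicator_rv d (O : measurableType d) (R : realType)
    (P : probability O R) (A : set O) : measurable A ->
  integrable_rv P (\1_A) /\ \int[P]_o (\1_A o : R) = pr P A.
Proof.
move=> mA; split; first exact: integrable_indic.
by rewrite /Rintegral integral_indic// setIT.
Qed.

Lemma finite_range_rv d (O : measurableType d) (R : realType)
    (P : probability O R) (I : finType) (g : O -> I) (h : I -> R) :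
  (forall i, measurable (g @^-1` [set i])) ->
  integrable_rv P (fun o => h (g o)) /\
  \int[P]_o h (g o) = \sum_i h i * pr P (g @^-1` [set i]).
Proof.
move=> mg.
have hE : (fun o => h (g o)) = fun o => \sum_i h i * \1_(g @^-1` [set i]) o.
  apply/funext => o; rewrite (bigD1 (g o))//= indicE mem_set// mulr1.
  rewrite big1 ?addr0// => i gi; rewrite indicE memNset ?mulr0//= => ig.
  by move/eqP: gi; rewrite ig.
have iI i : integrable_rv P (fun o => h i * \1_(g @^-1` [set i]) o).
  by apply: integrable_rvZ; exact: (indicator_rv P (mg i)).1.
split; first by rewrite hE; exact: integrable_rv_sum.
rewrite hE Rintegral_rv_sum//; apply: eq_bigr => i _.
by rewrite RintegralZl ?(indicator_rv P (mg i)).2//; exact: (indicator_rv P (mg i)).1.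
Qed.

(** * Fluctuations of the coupling weights *)

(** [average_weight] is the mean of [w] under the product measure, the equilibrium law of two
    distinct walks. The vertex [u] witnesses that [V] is inhabited. *)
Lemma average_weight_centered (R : realType) (V : finType) (w : V -> V -> R)
    (u : V) : skeleton w ->
  \sum_(c : V * V) (w c.1 c.2 - average_weight w) *
    (reversible_measure w c.1 * reversible_measure w c.2) = 0.
Proof.
move=> sw; under eq_bigr do rewrite mulrBl.
rewrite sumrB -mulr_sumr.
have -> : \sum_(c : V * V) (reversible_measure w c.1 * reversible_measure w c.2) = 1.
  rewrite -(pair_big xpredT xpredT (fun a b => reversible_measure w a * reversible_measure w b))/=.
  by rewrite -big_distrlr/= (sum_reversible_measure u sw) mulr1.
rewrite -(pair_big xpredT xpredT (fun a b =>
  w a b * (reversible_measure w a * reversible_measure w b)))/=.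
rewrite mulr1 /average_weight; apply/eqP; rewrite subr_eq0; apply/eqP.
by apply: eq_bigr => a _; apply: eq_bigr => b _; rewrite mulrA.
Qed.

(** A sum in place of a maximum: it dominates each weight and, term by term, [average_weight]. *)
Definition weight_bound (R : realType) (V : finType) (w : V -> V -> R) : R :=
  \sum_u \sum_v w u v.

Lemma le_weight_bound (R : realType) (V : finType) (w : V -> V -> R) (u v : V) :
  skeleton w -> 0 <= w u v <= weight_bound w.
Proof.
move=> [w0 _ _ _]; rewrite w0 /weight_bound (bigD1 u)//= (bigD1 v)//= -addrA lerDl.
by rewrite addr_ge0// ?sumr_ge0// => x _; rewrite sumr_ge0.
Qed.

Lemma average_weight_bounds (R : realType) (V : finType) (w : V -> V -> R) (u : V) :
  skeleton w -> 0 <= average_weight w <= weight_bound w.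
Proof.
move=> sw.
have mu0 x : 0 <= reversible_measure w x by exact: reversible_measure_ge0.
have w0 := skeleton_ge0 sw.
have mu1 x : reversible_measure w x <= 1.
  by rewrite -(sum_reversible_measure u sw) (bigD1 x)//= lerDl sumr_ge0.
apply/andP; split.
  apply: sumr_ge0 => a _; apply: sumr_ge0 => b _.
  by rewrite mulr_ge0 ?(mulr_ge0 (w0 a b)).
apply: ler_sum => a _; apply: ler_sum => b _.
rewrite -[leRHS]mulr1 ler_pM ?(mulr_ge0 (w0 a b))//.
by rewrite -[leRHS]mulr1 ler_pM.
Qed.

Lemma norm_centered_weight (R : realType) (V : finType) (w : V -> V -> R) (u v : V) :
  skeleton w -> `|w u v - average_weight w| <= weight_bound w.
Proof.
move=> sw; have /andP[a b] := le_weight_bound u v sw.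
have /andP[c e] := average_weight_bounds u sw.
by rewrite ler_norml; apply/andP; split; lra.
Qed.

Definition centered_weight (R : realType) (V : finType) (w : V -> V -> R)
  (O : Type) (X Y : R -> O -> V) (t : R) (o : O) : R :=
  w (X t o) (Y t o) - average_weight w.

(** By independence the two-time law of the pair factorizes over the walks, and mixing replaces each
    factor by the law at [s] times mu. Under the resulting law the later centered weight has mean
    0. *)
Lemma walk_pair_correlation (R : realType) (V : finType) (w : V -> V -> R)
    (eta : R) :
  skeleton w -> 0 < eta -> exists2 Lam, 0 < Lam &
  forall d (O : measurableType d) (P : probability O R) (rate : R) (N : nat)
    (x0 : 'I_N -> V) (X : 'I_N -> R -> O -> V) (i j : 'I_N) (s r : R),
  independent_walks P w rate x0 X -> 0 < rate -> i != j -> 0 <= s -> s < r ->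
  Lam <= rate * (r - s) ->
  `|\int[P]_o (centered_weight w (X i) (X j) s o *
               centered_weight w (X i) (X j) r o)| <= eta.
Proof.
move=> sw eta0.
pose A := weight_bound w.
(* Number of terms times the constant of each; one walk gets the tolerance [eta / (C + 1)]. *)
pose C := (#|{: (V * V) * (V * V)}|%:R * (A ^+ 2 * 2) : R).
have A0 (u : V) : 0 <= A.
  by have /andP[h1 h2] := le_weight_bound u u sw; exact: le_trans h1 h2.
have C0 : 0 <= C by rewrite mulr_ge0// mulr_ge0// sqr_ge0.
have eta'0 : 0 < eta / (C + 1) by rewrite divr_gt0// ltr_wpDl.
have [Lam Lam0 H] := random_walk_mixing sw eta'0.
exists Lam => // d O P rate N x0 X i j s r walks rate0 ij s0 sr Lamle.
have r0 : 0 <= r by rewrite (le_trans s0)// ltW.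
have rw k := independent_walks_walk walks k.
have mX k t B : 0 <= t -> measurable (X k t @^-1` B) by exact: random_walk_measurable.
have Hk k u v := H _ _ P rate (x0 k) (X k) s r u v (rw k) rate0 s0 sr Lamle.
pose g o := ((X i s o, X j s o), (X i r o, X j r o)).
pose f (c : V * V) := w c.1 c.2 - average_weight w.
have fA c : `|f c| <= A by exact: norm_centered_weight.
have gE c : g @^-1` [set c] =
    (X i s @^-1` [set c.1.1] `&` X i r @^-1` [set c.2.1]) `&`
    (X j s @^-1` [set c.1.2] `&` X j r @^-1` [set c.2.2]).
  by apply/seteqP; split=> [ o /= <-//|o]; rewrite /g/preimage/= => -[[-> ->] [-> ->]];
    case: c => -[? ?] [? ?].
have mg c : measurable (g @^-1` [set c]) by rewrite gE; do !apply: measurableI; exact: mX.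
have [_ ->] := finite_range_rv P (fun c => f c.1 * f c.2) mg.
pose q k (u : V) := pr P (X k s @^-1` [set u]).
pose mu := reversible_measure w.
have main0 : \sum_(c : (V * V) * (V * V))
    f c.1 * (q i c.1.1 * q j c.1.2) * (f c.2 * (mu c.2.1 * mu c.2.2)) = 0.
  rewrite -(pair_big xpredT xpredT (fun a b : V * V =>
    f a * (q i a.1 * q j a.2) * (f b * (mu b.1 * mu b.2))))/=.
  by rewrite -big_distrlr/= (average_weight_centered (x0 i) sw) mulr0.
rewrite -[X in `|X|]subr0 -[X in _ - X]main0 -sumrB.
apply: le_trans (ler_norm_sum _ _ _) _.
apply: (@le_trans _ _ (\sum_(c : (V * V) * (V * V)) A ^+ 2 * 2 * (eta / (C + 1)))).
  apply: ler_sum => c _.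
  have -> : pr P (g @^-1` [set c]) =
      pr P (X i s @^-1` [set c.1.1] `&` X i r @^-1` [set c.2.1]) *
      pr P (X j s @^-1` [set c.1.2] `&` X j r @^-1` [set c.2.2]).
    rewrite gE; apply: (independent_pair (independent_walks_indep walks) ij).
    - exact: process_sigmaI.
    - exact: process_sigmaI.
    - by apply: measurableI; exact: mX.
    - by apply: measurableI; exact: mX.
  have := Hk i c.1.1 c.2.1; have := Hk j c.1.2 c.2.2.
  rewrite -/(q i c.1.1) -/(q j c.1.2) -/(mu c.2.1) -/(mu c.2.2).
  set pi_ := pr P (X i s @^-1` [set c.1.1] `&` _).
  set pj_ := pr P (X j s @^-1` [set c.1.2] `&` _).
  have mu01 x : 0 <= mu x <= 1.
    rewrite /mu reversible_measure_ge0//= -(sum_reversible_measure x sw).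
    rewrite (bigD1 x)//= lerDl sumr_ge0// => y _; exact: reversible_measure_ge0.
  have q01 k x : 0 <= q k x <= 1 by rewrite pr_ge0 pr_le1//; exact: mX.
  move=> Hj Hi.
  (* Exchanges one factor at a time, with cofactors of absolute value at most 1. *)
  have -> : f c.1 * f c.2 * (pi_ * pj_) -
      f c.1 * (q i c.1.1 * q j c.1.2) * (f c.2 * (mu c.2.1 * mu c.2.2)) =
    (f c.1 * f c.2) * (pi_ * (pj_ - q j c.1.2 * mu c.2.2) +
      (q j c.1.2 * mu c.2.2) * (pi_ - q i c.1.1 * mu c.2.1)) by ring.
  have pi01 : `|pi_| <= 1.
    rewrite ger0_norm ?pr_ge0// pr_le1//; apply: measurableI; exact: mX.
  have qmu1 : `|q j c.1.2 * mu c.2.2| <= 1.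
    have /andP[q0 q1] := q01 j c.1.2; have /andP[mu0 mu1] := mu01 c.2.2.
    rewrite ger0_norm; last exact: mulr_ge0.
    exact: mulr_ile1.
  have -> : A ^+ 2 * 2 * (eta / (C + 1)) = (A * A) * (2 * (eta / (C + 1))) by ring.
  rewrite normrM; apply: ler_pM => //; first by rewrite normrM ler_pM.
  apply: le_trans (ler_normD _ _) _; rewrite mulr2n mulrDl mul1r.
  by apply: lerD; rewrite normrM -[leRHS]mul1r ler_pM.
have -> : \sum_(c : (V * V) * (V * V)) A ^+ 2 * 2 * (eta / (C + 1)) = eta * (C / (C + 1)).
  by rewrite sumr_const -mulr_natl /C; ring.
rewrite ler_piMr ?(ltW eta0)//.
by rewrite ler_pdivrMr ?ltr_wpDl// mul1r lerDl.
Qed.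

Lemma count_near (k l q : nat) :
  (\sum_(m < k) ((m < l + q) && (l < m + q)) <= 2 * q)%N.
Proof.
(* The counted [m] run from [l + 1 - q] to [l + q] excluded, cut at [k]; truncated subtraction takes
   care of the left end. *)
suff -> : (\sum_(m < k) ((m < l + q) && (l < m + q)) =
    minn (k - (l.+1 - q)) (l + q - (l.+1 - q)))%N by lia.
elim: k => [|k IH]; first by rewrite big_ord0; lia.
by rewrite big_ord_recr/= IH; case: (ltnP k (l + q)); case: (ltnP l (k + q)) => /=; lia.
Qed.

Lemma norm_Rintegral_le d (O : measurableType d) (R : realType)
    (P : probability O R) (Z : O -> R) (C : R) :
  integrable_rv P Z -> (forall o, `|Z o| <= C) -> `|\int[P]_o Z o| <= C.
Proof.
move=> iZ ZC; have ZC' o := ZC o; rewrite ler_norml.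
have up : \int[P]_o Z o <= C.
  rewrite -[leRHS](Rintegral_rv_cst P); apply: le_Rintegral => //.
    exact: integrable_rv_cst.
  by move=> o _; have := ZC o; rewrite ler_norml => /andP[].
have lo : - C <= \int[P]_o Z o.
  rewrite -[leLHS](Rintegral_rv_cst P); apply: le_Rintegral => //.
    exact: integrable_rv_cst.
  by move=> o _; have := ZC o; rewrite ler_norml => /andP[].
by rewrite lo up.
Qed.

Lemma integrable_centered_product d (O : measurableType d) (R : realType)
    (P : probability O R) (V : finType) (w : V -> V -> R) (X Y : R -> O -> V)
    (s r : R) :
  (forall t B, 0 <= t -> measurable (X t @^-1` B)) ->
  (forall t B, 0 <= t -> measurable (Y t @^-1` B)) -> 0 <= s -> 0 <= r ->
  integrable_rv P
    (fun o => centered_weight w X Y s o * centered_weight w X Y r o).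
Proof.
move=> mX mY s0 r0.
pose g o := ((X s o, X r o), (Y s o, Y r o)).
apply: (finite_range_rv P (fun c : (V * V) * (V * V) =>
  (w c.1.1 c.2.1 - average_weight w) * (w c.1.2 c.2.2 - average_weight w)) (g := g) _).1.
move=> c; have -> : g @^-1` [set c] =
    (X s @^-1` [set c.1.1] `&` X r @^-1` [set c.1.2]) `&`
    (Y s @^-1` [set c.2.1] `&` Y r @^-1` [set c.2.2]).
  by apply/seteqP; split=> [ o /= <-//|o]; rewrite /g/preimage/= => -[[-> ->] [-> ->]];
    case: c => -[? ?] [? ?].
by do !apply: measurableI; [exact: mX|exact: mX|exact: mY|exact: mY].
Qed.

Definition fluctuation (R : realType) (V : finType) (w : V -> V -> R)
  (O : Type) (X Y : R -> O -> V) (del : R) (k : nat) (o : O) : R :=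
  \sum_(l < k) del * centered_weight w X Y (l%:R * del) o.

Lemma fluctuation_sqrE (R : realType) (V : finType) (w : V -> V -> R)
    (O : Type) (X Y : R -> O -> V) (del : R) (k : nat) (o : O) :
  fluctuation w X Y del k o ^+ 2 =
  \sum_(l < k) \sum_(m < k) del ^+ 2 *
    (centered_weight w X Y (l%:R * del) o * centered_weight w X Y (m%:R * del) o).
Proof.
rewrite expr2 /fluctuation big_distrlr/=; apply: eq_bigr => l _.
by apply: eq_bigr => m _; ring.
Qed.

(** Each [l] has at most [2 * q] near partners, bounded by [A ^+ 2]; the others are at least
    [q * del = T / p] away, hence decorrelated. The bound is free of [q], so the mesh can be refined
    afterwards. *)
Lemma fluctuation_second_moment d (O : measurableType d) (R : realType)
    (P : probability O R) (V : finType) (w : V -> V -> R) (X Y : R -> O -> V)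
    (eta T tau : R) (p q k : nat) (A := weight_bound w)
    (del := T / (p * q)%:R) :
  skeleton w ->
  (forall t B, 0 <= t -> measurable (X t @^-1` B)) ->
  (forall t B, 0 <= t -> measurable (Y t @^-1` B)) ->
  0 <= eta -> 0 < T -> (0 < p)%N -> (0 < q)%N -> 0 < tau ->
  tau <= T / p%:R ->
  (forall s r, 0 <= s -> s + tau <= r ->
    `|\int[P]_o (centered_weight w X Y s o * centered_weight w X Y r o)| <= eta) ->
  (k <= p * q)%N ->
  integrable_rv P (fun o => fluctuation w X Y del k o ^+ 2) /\
  \int[P]_o (fluctuation w X Y del k o ^+ 2)
    <= T ^+ 2 * (2 * A ^+ 2 / p%:R + eta).
Proof.
move=> sw mX mY eta0 T0 p0 q0 tau0 taule corr kn.
have n0 : (0 : R) < (p * q)%:R by rewrite ltr0n muln_gt0 p0.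
have del0 : 0 < del by rewrite divr_gt0.
have grid0 (l : nat) : 0 <= l%:R * del by rewrite mulr_ge0// ltW.
have iF l m : integrable_rv P (fun o => del ^+ 2 *
    (centered_weight w X Y (l%:R * del) o * centered_weight w X Y (m%:R * del) o)).
  by apply: integrable_rvZ; exact: integrable_centered_product.
under [in X in X /\ _]eq_fun do rewrite fluctuation_sqrE.
under eq_Rintegral do rewrite fluctuation_sqrE.
have iS l : integrable_rv P (fun o => \sum_(m < k) del ^+ 2 *
    (centered_weight w X Y (l%:R * del) o * centered_weight w X Y (m%:R * del) o)).
  by apply: integrable_rv_sum => m; exact: iF.
split; first by apply: integrable_rv_sum => l; exact: iS.
rewrite Rintegral_rv_sum//.
have A20 : 0 <= A ^+ 2 by exact: sqr_ge0.
have far l m : (m < l + q)%N && (l < m + q)%N = false ->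
    `|\int[P]_o (centered_weight w X Y (l%:R * del) o *
       centered_weight w X Y (m%:R * del) o)| <= eta.
  have gap (a b : nat) : (a + q <= b)%N -> a%:R * del + tau <= b%:R * del.
    move=> ab; apply: (@le_trans _ _ (a%:R * del + q%:R * del)).
      rewrite lerD2l (le_trans taule)// le_eqVlt; apply/orP; left; apply/eqP.
      by rewrite /del natrM; field; rewrite !pnatr_eq0 -!lt0n p0 q0.
    by rewrite -mulrDl -natrD ler_pM2r// ler_nat.
  move/negbT; rewrite negb_and -!leqNgt => /orP[h|h]; last first.
    under eq_Rintegral do rewrite mulrC.
    by apply: corr => //; exact: gap.
  by apply: corr => //; exact: gap.
have entry l m : \int[P]_o (del ^+ 2 * (centered_weight w X Y (l%:R * del) o *
      centered_weight w X Y (m%:R * del) o)) <=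
    del ^+ 2 * (A ^+ 2 * ((m < l + q)%N && (l < m + q)%N)%:R + eta).
  rewrite RintegralZl//; last exact: integrable_centered_product.
  rewrite ler_wpM2l ?sqr_ge0// (le_trans (ler_norm _))//.
  case near_lm : ((m < l + q)%N && (l < m + q)%N); last first.
    by rewrite mulr0 add0r far.
  rewrite mulr1 -[leLHS]addr0 lerD//; apply: norm_Rintegral_le.
    exact: integrable_centered_product.
  by move=> o; rewrite normrM expr2 ler_pM// norm_centered_weight.
have row l : \int[P]_o (\sum_(m < k) del ^+ 2 * (centered_weight w X Y (l%:R * del) o *
      centered_weight w X Y (m%:R * del) o)) <=
    del ^+ 2 * (A ^+ 2 * (2 * q%:R) + (p * q)%:R * eta).
  rewrite Rintegral_rv_sum; last by move=> m; exact: iF.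
  apply: le_trans (ler_sum _ (fun (m : 'I_k) _ => entry l m)) _.
  rewrite -mulr_sumr ler_wpM2l ?sqr_ge0// big_split/= -mulr_sumr.
  rewrite sumr_const card_ord -[eta *+ k]mulr_natl lerD//.
    have -> : 2 * q%:R = (2 * q)%:R :> R by rewrite natrM.
    by rewrite ler_wpM2l// -natr_sum ler_nat count_near.
  by rewrite ler_wpM2r// ler_nat.
apply: le_trans (ler_sum _ (fun (l : 'I_k) _ => row l)) _.
rewrite sumr_const card_ord -[leLHS]mulr_natl.
have c0 : 0 <= del ^+ 2 * (A ^+ 2 * (2 * q%:R) + (p * q)%:R * eta).
  by rewrite mulr_ge0 ?sqr_ge0// addr_ge0// mulr_ge0// mulr_ge0.
apply: (@le_trans _ _ ((p * q)%:R * (del ^+ 2 * (A ^+ 2 * (2 * q%:R) + (p * q)%:R * eta)))).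
  by rewrite ler_wpM2r// ler_nat.
rewrite le_eqVlt; apply/orP; left; apply/eqP; rewrite /del natrM; field.
by rewrite !pnatr_eq0 -!lt0n p0 q0.
Qed.

Lemma fluctuation_increment (R : realType) (V : finType) (w : V -> V -> R)
    (O : Type) (X Y : R -> O -> V) (del : R) (k l : nat) (o : O) :
  skeleton w -> 0 <= del -> (k <= l)%N ->
  `|fluctuation w X Y del l o - fluctuation w X Y del k o|
    <= (l - k)%:R * (del * weight_bound w).
Proof.
move=> sw del0; elim: l => [|l IH].
  by rewrite leqn0 => /eqP->; rewrite subrr normr0 mul0r.
rewrite leq_eqVlt ltnS => /predU1P[->|kl]; first by rewrite subrr normr0 subnn mul0r.
rewrite /fluctuation big_ord_recr/= -/(fluctuation w X Y del l o).
rewrite addrAC subSn// -natr1 mulrDl mul1r (le_trans (ler_normD _ _))// lerD ?IH//.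
by rewrite normrM ger0_norm// ler_wpM2l// norm_centered_weight.
Qed.

(** Trades a first moment for a second one without square roots. Being linear in [x ^+ 2], it bounds
    a maximum of finitely many terms by a sum of squares. *)
Lemma norm_le_sqr_div (R : realType) (x e : R) : 0 < e -> `|x| <= e + x ^+ 2 / e.
Proof.
move=> e0; rewrite -(ler_pM2r e0) mulrDl divfK ?lt0r_neq0// -real_normK ?num_real//.
have := sqr_ge0 (`|x| - e); have := normr_ge0 x; set y := `|x|.
by move=> y0; rewrite !expr2 => h; have := mulr_ge0 y0 (ltW e0); nra.
Qed.

Lemma exists_nat_quotient_le (R : realType) (c e : R) :
  0 <= c -> 0 < e -> exists2 m, (0 < m)%N & c / m%:R <= e.
Proof.
move=> c0 e0; exists (Num.truncn (c / e)).+1 => //.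
have /truncn_itv/andP[_ h] : 0 <= c / e by rewrite divr_ge0// ltW.
by rewrite ler_pdivrMr ?ltr0n// mulrC -ler_pdivrMr// ltW.
Qed.

(* The supremum over k is reduced to a coarse grid of m points, on which the
   second moments are small because correlations decay at a finer scale. *)
Lemma fluctuation_uniform (R : realType) (V : finType) (w : V -> V -> R)
    (N : nat) (T e : R) :
  skeleton w -> 0 < T -> 0 < e ->
  exists2 p : nat, (0 < p)%N & exists2 Lam, 0 < Lam &
  forall d (O : measurableType d) (P : probability O R) (rate : R)
    (x0 : 'I_N -> V) (X : 'I_N -> R -> O -> V),
  independent_walks P w rate x0 X -> 0 < rate -> Lam <= rate ->
  forall q, (0 < q)%N -> exists S : O -> R, [/\ integrable_rv P S,
    forall o, 0 <= S o, \int[P]_o S o <= e &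
    forall o i j k, i != j -> (k <= p * q)%N ->
      `|fluctuation w (X i) (X j) (T / (p * q)%:R) k o| <= S o].
Proof.
move=> sw T0 e0; set A := weight_bound w.
have A0 : 0 <= A.
  by apply: sumr_ge0 => u _; apply: sumr_ge0 => v _; exact: skeleton_ge0.
have e3 : 0 < e / 3 by rewrite divr_gt0.
(* Coarse spacing [T / m]: between neighbouring coarse points the fluctuation moves by at most
   [A * T / m]. *)
have [m m0 mle] := exists_nat_quotient_le (mulr_ge0 A0 (ltW T0)) e3.
(* Factor gathered from the number of pairs and coarse points, the division by [e / 3] and [T ^+ 2];
   [eta] is set so that [Q * (2 * eta) <= e / 3]. *)
pose Q := #|{: 'I_N * 'I_N}|%:R * m.+1%:R / (e / 3) * T ^+ 2.
have Q0 : 0 <= Q by rewrite mulr_ge0 ?sqr_ge0// divr_ge0 ?mulr_ge0// ltW.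
pose eta := e / 6 / (Q + 1).
have Q1 : 0 < Q + 1 by rewrite ltr_wpDl.
have eta0 : 0 < eta by rewrite !divr_gt0.
have A20 : 0 <= 2 * A ^+ 2 by rewrite mulr_ge0// sqr_ge0.
(* Brings the near-diagonal part of the second moment below [eta] as well. *)
have [M M0 Mle] := exists_nat_quotient_le A20 eta0.
have [Lam0 Lam00 corr] := walk_pair_correlation sw eta0.
have p0 : (0 < m * M)%N by rewrite muln_gt0 m0.
exists (m * M)%N => //.
pose tau := T / (m * M)%:R.
have tau0 : 0 < tau by rewrite divr_gt0// ltr0n.
exists (Lam0 / tau); first exact: divr_gt0.
move=> d O P rate x0 X walks rate0 Lamle q q0.
set del := T / (m * M * q)%:R.
have del0 : 0 < del by rewrite divr_gt0// ltr0n muln_gt0 p0.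
have mX i t B : 0 <= t -> measurable (X i t @^-1` B).
  exact: random_walk_measurable (independent_walks_walk walks i).
pose Z (c : 'I_N * 'I_N) (r : 'I_m.+1) : O -> R :=
  if c.1 == c.2 then fun=> 0
  else fun o => fluctuation w (X c.1) (X c.2) del (r * (M * q)) o ^+ 2.
pose D := T ^+ 2 * (2 * A ^+ 2 / (m * M)%:R + eta).
have D0 : 0 <= D by rewrite mulr_ge0 ?sqr_ge0// addr_ge0// ?divr_ge0// ltW.
have ZP c r : integrable_rv P (Z c r) /\ \int[P]_o Z c r o <= D.
  rewrite /Z; case: eqP => [_|/eqP c12].
    by split; [exact: integrable_rv_cst | rewrite Rintegral_rv_cst].
  apply: (@fluctuation_second_moment _ _ _ P V w (X c.1) (X c.2) eta T tau) => //.
  - exact: mX.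
  - exact: mX.
  - exact: ltW.
  - move=> s t s0 st; apply: (corr _ _ P rate N x0) => //.
      by apply: lt_le_trans st; rewrite ltrDl.
    apply: le_trans (_ : rate * tau <= _).
      by rewrite -ler_pdivrMr.
    by rewrite ler_pM2l// lerBrDl.
  - by rewrite -mulnA leq_mul2r -ltnS ltn_ord orbT.
have Z0 c r o : 0 <= Z c r o by rewrite /Z; case: eqP => // _; exact: sqr_ge0.
pose W o := \sum_c \sum_r Z c r o.
have iW : integrable_rv P W.
  by apply: integrable_rv_sum => c; apply: integrable_rv_sum => r; exact: (ZP c r).1.
have WD : \int[P]_o W o <= #|{: 'I_N * 'I_N}|%:R * m.+1%:R * D.
  rewrite Rintegral_rv_sum; last first.
    by move=> c; apply: integrable_rv_sum => r; exact: (ZP c r).1.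
  apply: (@le_trans _ _ (\sum_(c : 'I_N * 'I_N) m.+1%:R * D)); last first.
    by rewrite sumr_const -[leLHS]mulr_natl mulrA.
  apply: ler_sum => c _; rewrite Rintegral_rv_sum; last by move=> r; exact: (ZP c r).1.
  apply: (@le_trans _ _ (\sum_(r < m.+1) D)); last first.
    by rewrite sumr_const card_ord -[leLHS]mulr_natl.
  by apply: ler_sum => r _; exact: (ZP c r).2.
(* Three shares of [e]: the normalized squares, the additive constant of [norm_le_sqr_div], and the
   motion between coarse points. *)
exists (fun o => (e / 3)^-1 * W o + (e / 3 + A * T / m%:R)).
have W0 o : 0 <= W o by apply: sumr_ge0 => c _; apply: sumr_ge0.
have ATm : 0 <= A * T / m%:R by rewrite !mulr_ge0// ltW.
split.
- by apply: integrable_rvD; [exact: integrable_rvZ | exact: integrable_rv_cst].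
- by move=> o; rewrite addr_ge0 ?mulr_ge0 ?invr_ge0 ?addr_ge0// ltW.
- rewrite Rintegral_rvD; [|exact: integrable_rvZ|exact: integrable_rv_cst].
  rewrite Rintegral_rv_cst RintegralZl//.
  have e3' : 0 <= (e / 3)^-1 by rewrite invr_ge0 ltW.
  have h1 := ler_wpM2l e3' WD.
  have h2 : D <= T ^+ 2 * (2 * eta).
    have -> : 2 * eta = eta + eta by ring.
    rewrite ler_wpM2l ?sqr_ge0// lerD2r (le_trans _ Mle)//.
    rewrite ler_wpM2l// lef_pV2 ?posrE ?ltr0n// ler_nat.
    by rewrite leq_pmull.
  have c0 : 0 <= (e / 3)^-1 * (#|{: 'I_N * 'I_N}|%:R * m.+1%:R) by rewrite mulr_ge0// mulr_ge0.
  have := ler_wpM2l c0 h2.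
  have -> : (e / 3)^-1 * (#|{: 'I_N * 'I_N}|%:R * m.+1%:R) * (T ^+ 2 * (2 * eta)) =
    Q * (2 * eta) by rewrite /Q; ring.
  have h3 : Q * (2 * eta) <= e / 3.
    have -> : Q * (2 * eta) = e / 3 * (Q / (Q + 1)).
      by rewrite /eta; field; rewrite lt0r_neq0.
    by rewrite ler_piMr ?(ltW e3)// ler_pdivrMr// mul1r lerDl.
  move=> h4; rewrite [leRHS]mulrA in h1; have h5 := le_trans h1 (le_trans h4 h3).
  move: h5 mle; set y := _ * Rintegral _ _ _; set z := A * T / _; lra.
(* [s] fine cells make a coarse one; [k] is rounded down to a multiple of [s]. *)
- move=> o i j k ij kn; pose s := (M * q)%N.
  have s0 : (0 < s)%N by rewrite muln_gt0 M0.
  have rm : (k %/ s < m.+1)%N.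
    by rewrite ltnS -(mulnK m s0) leq_div2r// mulnA.
  have ks : (k %/ s * s <= k)%N by exact: leq_trunc_div.
  have := fluctuation_increment (X i) (X j) o sw (ltW del0) ks.
  have Zi : Z (i, j) (Ordinal rm) o =
      fluctuation w (X i) (X j) del (k %/ s * s) o ^+ 2.
    by rewrite /Z/= (negPf ij).
  have ZW : Z (i, j) (Ordinal rm) o <= W o.
    rewrite /W (bigD1 (i, j))//= (bigD1 (Ordinal rm))//= -addrA lerDl.
    by rewrite addr_ge0// ?sumr_ge0// => c _; rewrite sumr_ge0.
  have := norm_le_sqr_div (fluctuation w (X i) (X j) del (k %/ s * s) o) e3.
  set F := fluctuation w (X i) (X j) del (k %/ s * s) o in Zi *.
  set F' := fluctuation w (X i) (X j) del k o.
  rewrite -Zi => h1 h2.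
  have h3 : (k - k %/ s * s)%:R * (del * A) <= A * T / m%:R.
    have -> : A * T / m%:R = s%:R * (del * A).
      by rewrite /del /s !natrM; field; rewrite !pnatr_eq0 -!lt0n m0 M0 q0.
    apply: ler_wpM2r (mulr_ge0 (ltW del0) A0) _ _ _; rewrite ler_nat.
    have -> : (k - k %/ s * s = k %% s)%N by rewrite {1}(divn_eq k s) addKn.
    by rewrite ltnW// ltn_mod.
  have h4 : Z (i, j) (Ordinal rm) o / (e / 3) <= (e / 3)^-1 * W o.
    by rewrite mulrC ler_wpM2l// invr_ge0 ltW.
  have -> : F' = F + (F' - F) by ring.
  apply: le_trans (ler_normD _ _) _; move: h1 h2 h3 h4; rewrite -/A.
  set a := `|F|; set b := `|F' - F|; set z1 := _ / (e / 3); set z2 := _ * W o.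
  set z3 := A * T / _; set z4 := _ * (del * A); lra.
Qed.

(** * Averaging in expectation *)

Lemma random_walk_jump d (O : measurableType d) (R : realType)
    (P : probability O R) (V : finType) (p : V -> V -> R) (rate : R) (v0 : V)
    (X : R -> O -> V) (s t : R) :
  random_walk P p rate v0 X -> 0 < rate -> 0 <= s -> s < t ->
  exists E, [/\ measurable E, pr P E <= rate * (t - s) &
    forall o tau, ~ E o -> s <= tau <= t -> X tau o = X s o].
Proof.
move=> [Y [M [_ pp _ XE]]] rate0 s0 st; have t0 : 0 <= t by rewrite (le_trans s0)// ltW.
(* Jumps from a vertex to itself count too; off this event the counter, being monotone, is constant
   and the walk frozen. *)
exists [set o | M s o != M t o]; split.
- exact: (poisson_increment_measurable (fun a b => a != b) pp).
- exact: (poisson_jump_le pp).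
- move=> o tau /negP; rewrite negbK => /eqP Mst /andP[stau taut].
  have tau0 := le_trans s0 stau; rewrite !XE//.
  suff -> : M tau o = M s o by [].
  have h1 := poisson_process_mono pp o s0 stau.
  have h2 := poisson_process_mono pp o tau0 taut.
  by apply/eqP; rewrite eqn_leq h1 andbT Mst.
Qed.

(* No measurability of F: the integral of a nonnegative function is a supremum
   over the simple functions below it. *)
Lemma expectation_le_integrable d (O : measurableType d) (R : realType)
    (P : probability O R) (F G : O -> R) :
  (forall o, 0 <= F o) -> (forall o, F o <= G o) -> integrable_rv P G ->
  ('E_P[F] <= (\int[P]_o G o)%:E)%E.
Proof.
move=> F0 FG iG.
have G0 o : 0 <= G o by exact: le_trans (F0 o) (FG o).
rewrite unlock /Rintegral fineK; last exact: integrable_fin_num.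
rewrite !ge0_integralTE//; try by move=> o; rewrite lee_fin.
apply: ereal_sup_le => _ [h /= hF <-]; exists h => //= o.
by apply: le_trans (hF o) _; rewrite lee_fin.
Qed.

(** [Lam] is fixed before the space, the starting points and [alpha], whence the uniformity. [F]
    stands for the supremum over time and is known only through the upper bounds it respects. *)
Lemma walk_averaging (R : realType) (V : finType) (w : V -> V -> R) (K : R)
    (N : nat) (omega : 'I_N -> R) (T e : R) :
  skeleton w -> 0 < K -> (0 < N)%N -> 0 < T -> 0 < e -> exists2 Lam, 0 < Lam &
  forall d (O : measurableType d) (P : probability O R) (rate : R)
    (x0 : 'I_N -> V) (X : 'I_N -> R -> O -> V) (alpha : 'I_N -> torus R)
    (theta : O -> R -> 'I_N -> torus R) (thetabar : R -> 'I_N -> torus R)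
    (F : O -> R),
  independent_walks P w rate x0 X -> 0 < rate -> Lam <= rate ->
  (forall o, caratheodory_solution (KRW_field w K omega X o) alpha (theta o)) ->
  classical_solution (averaged_field w K omega) alpha thetabar ->
  (forall o, 0 <= F o) ->
  (forall o M, (forall t, 0 <= t <= T ->
     torus_dist (theta o t) (thetabar t) <= M) -> F o <= M) ->
  ('E_P[F] <= e%:E)%E.
Proof.
move=> sw K0 N0 T0 e0; set A := weight_bound w.
have A0 : 0 <= A.
  by apply: sumr_ge0 => u _; apply: sumr_ge0 => v _; exact: skeleton_ge0.
pose B := \sum_j `|omega j| + K * A.
have KA0 : 0 <= K * A by rewrite mulr_ge0// ltW.
have B0 : 0 <= B by rewrite addr_ge0 ?sumr_ge0.
pose C := K * (A * (2 * B)) + 2 * (K * A).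
have C0 : 0 <= C by rewrite addr_ge0// ?mulr_ge0// ltW.
pose x := expR (K * (A * 2) * T).
have x_ge0 : 0 <= x by exact: expR_ge0.
pose c1 := K * (1 + 2 * (B * T)) * x.
have BT0 : 0 <= 2 * (B * T) by rewrite !mulr_ge0// ltW.
have c10 : 0 <= c1 by rewrite mulr_ge0// mulr_ge0 ?(ltW K0)// addr_ge0.
have c11 : 0 < c1 + 1 by rewrite ltr_wpDl.
have e1 : 0 < e / 2 / (c1 + 1) by rewrite !divr_gt0.
have [p p0 [Lam Lam0 H]] := @fluctuation_uniform R V w N T _ sw T0 e1.
exists Lam => // d O P rate x0 X alpha theta thetabar F walks rate0 Lamle sol solbar F0 FM.
(* Coefficient of [del] in the expected remainder. It grows with [rate]; [q] is chosen afterwards to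
   absorb it, with [p] and [Lam] untouched. *)
pose c2 := C * x * (T * N%:R * rate + 2 * T) + 2 * B.
have c20 : 0 <= c2.
  have h1 : 0 <= T * N%:R * rate by rewrite mulr_ge0 ?(ltW rate0)// mulr_ge0// ltW.
  by rewrite /c2 addr_ge0// mulr_ge0// ?addr_ge0// ?mulr_ge0// ltW.
have e2 : 0 < e / 2 by rewrite divr_gt0.
have [q q0 qle] := exists_nat_quotient_le (mulr_ge0 (ltW T0) c20) e2.
have [S [iS S0 Se HS]] := H _ O P rate x0 X walks rate0 Lamle q q0.
set n := (p * q)%N in HS; have n0 : (0 < n)%N by rewrite muln_gt0 p0.
set del := T / n%:R in HS.
have n0R : (0 : R) < n%:R by rewrite ltr0n.
have del0 : 0 < del by rewrite divr_gt0.
have ndel : n%:R * del = T by rewrite mulrC divfK// lt0r_neq0.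
have grid0 (k : nat) : 0 <= k%:R * del by rewrite mulr_ge0// ltW.
have gridS (k : nat) : k.+1%:R * del - k%:R * del = del by rewrite -natr1; ring.
have gridlt (k : nat) : k%:R * del < k.+1%:R * del by rewrite -subr_gt0 gridS.
have jumpE (c : 'I_N * nat) := cid (random_walk_jump
  (independent_walks_walk walks c.1) rate0 (grid0 c.2) (gridlt c.2)).
pose E i k := projT1 (jumpE (i, k)).
have EP i k : [/\ measurable (E i k), pr P (E i k) <= rate * del &
    forall o tau, ~ E i k o -> k%:R * del <= tau <= k.+1%:R * del ->
      X i tau o = X i (k%:R * del) o].
  have [h1 h2 h3] := projT2 (jumpE (i, k)); split=> //.
  by rewrite -(gridS k).
(* Counts pairs of a walk and a cell, so it dominates the number of cells with a jump; the bound
   [T * N * rate] on its mean is free of the mesh. *)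
pose J o : R := \sum_(k < n) \sum_(i < N) \1_(E i k) o.
have iE i (k : 'I_n) : integrable_rv P (\1_(E i k)).
  by have [mE _ _] := EP i k; exact: (indicator_rv P mE).1.
have iJk (k : 'I_n) : integrable_rv P (fun o => \sum_(i < N) \1_(E i k) o).
  by apply: integrable_rv_sum => i; exact: iE.
have iJ : integrable_rv P J by apply: integrable_rv_sum => k; exact: iJk.
have JE : \int[P]_o J o <= T * N%:R * rate.
  rewrite Rintegral_rv_sum//.
  apply: (@le_trans _ _ (\sum_(k < n) \sum_(i < N) rate * del)); last first.
    rewrite !sumr_const !card_ord -[X in X <= _]mulr_natl -[X in _ * X <= _]mulr_natl.
    by rewrite -ndel le_eqVlt; apply/orP; left; apply/eqP; ring.
  apply: ler_sum => k _; rewrite Rintegral_rv_sum//; apply: ler_sum => i _.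
  by have [mE h _] := EP i k; rewrite (indicator_rv P mE).2.
pose G o := c1 * S o + (C * x * del * J o + (C * x * (2 * T) + 2 * B) * del).
have iG : integrable_rv P G.
  apply: integrable_rvD; first exact: integrable_rvZ.
  by apply: integrable_rvD; [exact: integrable_rvZ | exact: integrable_rv_cst].
apply: le_trans (expectation_le_integrable F0 _ iG) _; last first.
  rewrite lee_fin Rintegral_rvD; [|exact: integrable_rvZ|]; last first.
    by apply: integrable_rvD; [exact: integrable_rvZ | exact: integrable_rv_cst].
  rewrite Rintegral_rvD; [|exact: integrable_rvZ|exact: integrable_rv_cst].
  rewrite Rintegral_rv_cst !RintegralZl//.
  have h1 : c1 * \int[P]_o S o <= e / 2.
    apply: le_trans (ler_wpM2l c10 Se) _.
    have -> : c1 * (e / 2 / (c1 + 1)) = e / 2 * (c1 / (c1 + 1)) by ring.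
    by rewrite ler_piMr ?(ltW e2)// ler_pdivrMr// mul1r lerDl.
  have CJ : 0 <= C * x * del by rewrite !mulr_ge0// ltW.
  have h2 := ler_wpM2l CJ JE.
  have h3 : c2 * del <= e / 2.
    apply: le_trans qle.
    have -> : c2 * del = T * c2 / n%:R by rewrite /del; ring.
    apply: ler_wpM2l; first exact: mulr_ge0 (ltW T0) c20.
    by rewrite lef_pV2 ?posrE ?ltr0n// ler_nat leq_pmull.
  have -> : e = e / 2 + e / 2 by lra.
  apply: lerD => //; apply: le_trans h3; rewrite /c2.
  apply: le_trans (lerD h2 (lexx _)) _.
  by rewrite le_eqVlt; apply/orP; left; apply/eqP; ring.
move=> o; apply: FM => t tT.
pose a t (i j : 'I_N) := w (X i t o) (X j t o).
pose jump k := [exists i, `[< E i k o >]].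
have aA s i j : `|a s i j| <= A.
  by have /andP[h1 h2] := le_weight_bound (X i s o) (X j s o) sw; rewrite ger0_norm.
have abarA : `|average_weight w| <= A.
  have /andP[h1 h2] := average_weight_bounds (x0 (Ordinal N0)) sw.
  by rewrite ger0_norm.
have := @averaging_pathwise R N K A (average_weight w) T (S o) n omega a alpha
  (theta o) thetabar jump (ltW K0) A0 T0 n0 (S0 o) aA abarA (sol o) solbar.
rewrite -/B -/del -/C -/x => /(_ _ _ t tT) main.
apply: le_trans (main _ _) _.
- move=> k s kn njump ks; apply/funext => i; apply/funext => j.
  have nE l : ~ E l k o.
    by move=> El; move/negP: njump; apply; apply/existsP; exists l; apply/asboolP.
  rewrite /a; have [_ _ h] := EP i k; have [_ _ h'] := EP j k.
  by rewrite (h o s)// (h' o s).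
- by move=> i j m ij mn; exact: HS.
have jumpJ : \sum_(l < n) (jump l)%:R <= J o.
  apply: ler_sum => l _; rewrite /jump; case: existsP => [[i /asboolP Ei]|_].
    by rewrite (bigD1 i)//= indicE mem_set// lerDl sumr_ge0.
  by rewrite sumr_ge0.
have Cx : 0 <= C * x * del by rewrite !mulr_ge0// ltW.
have := ler_wpM2l Cx jumpJ; rewrite /G /c1.
set y := \sum_(l < n) _ => h.
rewrite -subr_ge0 in h; rewrite -subr_ge0.
rewrite (_ : _ - _ = C * x * del * J o - C * x * del * y)//.
by ring.
Qed.

Theorem proposition1p8 (R : realType) (V : finType) (w : V -> V -> R)
    (w_skeleton : skeleton w) (K : R) (K_gt0 : 0 < K)
    (N : nat) (N_ge2 : (2 <= N)%N) (omega : 'I_N -> R)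
    (d : measure_display) (O : R -> measurableType d)
    (P : forall eps : R, probability (O eps) R)
    (x0 : R -> 'I_N -> V)
    (X : forall eps : R, 'I_N -> R -> O eps -> V)
    (X_walks : forall eps : R, 0 < eps ->
      independent_walks (P eps) w eps^-1 (x0 eps) (X eps))
    (theta : forall eps : R, ('I_N -> torus R) ->
      O eps -> R -> 'I_N -> torus R)
    (theta_sol : forall (eps : R) (alpha : 'I_N -> torus R) (o : O eps),
      0 < eps ->
      caratheodory_solution (KRW_field w K omega (X eps) o) alpha
        (theta eps alpha o))
    (thetabar : ('I_N -> torus R) -> R -> 'I_N -> torus R)
    (thetabar_sol : forall alpha : 'I_N -> torus R,
      classical_solution (averaged_field w K omega) alpha (thetabar alpha))
    (T : R) (T_ge0 : 0 <= T) :
  ereal_sup [set 'E_(P eps)[(fun o : O eps =>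
      sup [set torus_dist (theta eps alpha o t) (thetabar alpha t)
          | t in [set` `[0, T]]])%R]%E
    | alpha in [set: 'I_N -> torus R]]
    @[eps --> 0^'+] --> 0%E.
Proof.
(* [T] may be 0, while the grid needs a positive horizon. *)
have T1 : 0 < T + 1 by rewrite ltr_wpDl.
set f := fun eps : R => ereal_sup _.
have T0in : [set` `[0, T]] 0 by rewrite /= in_itv/= lexx.
suff fP e : 0 < e -> \forall eps \near 0^'+, (0 <= f eps <= e%:E)%E.
  have ffin e' eps : (0 <= f eps <= e'%:E)%E -> f eps \is a fin_num.
    by move=> /andP[f0 fe]; rewrite ge0_fin_numE// (le_lt_trans fe)// ltry.
  apply/fine_cvgP; split; first by apply: filterS (fP 1 ltr01) => eps /ffin.
  apply/cvgrPdist_le => e e0; apply: filterS (fP e e0) => eps fe /=.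
  rewrite sub0r normrN -lee_fin; have /andP[f0 f1] := fe.
  by rewrite ger0_norm ?fine_ge0// fineK ?(ffin _ _ fe).
move=> e0.
have [Lam Lam0 H] := walk_averaging omega w_skeleton K_gt0 (ltnW N_ge2) T1 e0.
near=> eps.
have eps0 : 0 < eps by near: eps; exact: nbhs_right_gt.
have Lamle : Lam <= eps^-1.
  by rewrite -[leLHS]invrK lef_pV2 ?posrE ?invr_gt0//; near: eps;
    apply: nbhs_right_le; rewrite invr_gt0.
have dist_ub alpha o M : (forall t, 0 <= t <= T + 1 ->
    torus_dist (theta eps alpha o t) (thetabar alpha t) <= M) ->
    ubound [set torus_dist (theta eps alpha o t) (thetabar alpha t)
          | t in [set` `[0, T]]] M.
  move=> HM _ [t /= + <-]; rewrite in_itv/= => /andP[t0 tT].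
  by apply: HM; rewrite t0 (le_trans tT)// lerDl.
have dist0 alpha o : 0 <= sup [set torus_dist (theta eps alpha o t) (thetabar alpha t)
          | t in [set` `[0, T]]].
  (* Without a supremum, [sup] takes the default value 0. *)
  set D := [set _ | t in _]; have [hs|/sup_out->//] := pselect (has_sup D).
  apply: le_trans (torus_dist_ge0 _ _) (ub_le_sup hs.2 _); by exists 0.
apply/andP; split.
  (* Any one initial condition bounds the supremum below by a nonnegative expectation. *)
  apply: (@le_trans _ _ ('E_(P eps)[(fun o : O eps =>
      sup [set torus_dist (theta eps (fun=> to_torus 0) o t)
             (thetabar (fun=> to_torus 0) t)
          | t in [set` `[0, T]]])%R])%E).
    exact: expectation_ge0.
  by apply: ereal_sup_ubound; exists (fun=> to_torus 0).
apply: ge_ereal_sup => _ [alpha _ <-].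
apply: (H _ _ (P eps) eps^-1 (x0 eps) (X eps) alpha (theta eps alpha)
  (thetabar alpha)) => //.
- exact: X_walks.
- by rewrite invr_gt0.
- by move=> o; exact: theta_sol.
- move=> o M HM; apply: ge_sup; last exact: dist_ub HM.
  by exists (torus_dist (theta eps alpha o 0) (thetabar alpha 0)); exists 0.
Unshelve. all: by end_near.
Qed.
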